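(* For any $n\geq 3$ and $q\geq 3$, there is no $q\times 2^{\ell}$ matrix $M$ (for any $\ell\ge 1$) of rank $q$ such that the transformed Equality function $(=_n)M^{\otimes n}$ by $M$ can be realized by a matchgate signature, where $(=_n)$ is the Equality function on $n$ variables over the domain $[q]$.
   Context: Let $[q]=\{0,1,\dots,q-1\}$. The $n$-ary Equality signature $(=_n)$ over domain $[q]$ is the function $[q]^n\to\mathbb{C}$ taking value 1 on inputs with $x_1=x_2=\cdots=x_n$ and 0 otherwise, viewed as a row vector in $\mathbb{C}^{q^n}$. For a $q\times 2^{\ell}$ matrix $M$, the transformed signature $(=_n)M^{\otimes n}$ is a function on $\{0,1\}^{n\ell}$ (Boolean domain, arity $n\ell$). A matchgate is a tuple $(G,X)$ where $G=(V,E,W)$ is a weighted undirected planar graph and $X\subset V$ is a set of external nodes ordered counterclockwise on the external face; a matchgate with $k$ external nodes has signature $\Gamma^{i_1\cdots i_k}=\mathrm{PerfMatch}(G-Z)$ (sum over perfect matchings of $G-Z$ of the product of edge weights), where $Z\subset X$ has characteristic sequence $i_1\cdots i_k$. A Boolean-domain signature is realized by a matchgate (is a matchgate signature) if it equals the signature of some matchgate. *)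

(* Defs.v *)
From HB Require Import structures.
From mathcomp Require Import all_boot all_order all_fingroup all_algebra.
From mathcomp Require Import reals.
From mathcomp.real_closed Require Import complex mxtens.

Set Implicit Arguments.
Unset Strict Implicit.
Unset Printing Implicit Defensive.

Import GRing.Theory.

Local Open Scope ring_scope.

(* A symmetric irreflexive relation r on T is a finite simple graph; its darts
   (directed edges) are the pairs (u, v) with r u v. *)
Section PlaneEmbeddings.

Variables (T : finType) (r : rel T).

Definition darts : {set T * T} := [set d | r d.1 d.2].

Definition dart_rev (d : T * T) : T * T := (d.2, d.1).

(* s sends a dart to the next dart counterclockwise around its source.  Only
   the values of s on darts matter. *)
Definition rotation_system (s : {perm T * T}) : Prop :=
  forall d, d \in darts ->
  forall d', fconnect s d d' = (d' \in darts) && (d'.1 == d.1).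

(* The boundary walks of the faces are the orbits of this map. *)
Definition face_next (s : {perm T * T}) (d : T * T) : T * T := s (dart_rev d).

Definition nonisolated : {set T} := [set u | [exists v, r u v]].

(* Euler's formula V - E + F = 2 C.  Boundary walks are counted separately
   in each connected component, so that the formula says that every component
   is drawn on a sphere.  Isolated vertices, which have no darts, are left
   out of V and C.  Each edge is a pair of opposite darts. *)
Definition plane_rotation (s : {perm T * T}) : Prop :=
  rotation_system s /\
  (#|nonisolated| + fcard (face_next s) darts =
     #|darts|./2 + 2 * n_comp r nonisolated)%N.

End PlaneEmbeddings.

(* A graph is drawn in the plane with the external nodes x_0, ..., x_(k-1) on
   the external face, in this counterclockwise order, when dangling edges can
   be drawn from the x_i to infinity through the external face, leaving in this
   order.  On the sphere the dangling edges meet at the point at infinity,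
   the vertex None below.  This is also meaningful for disconnected graphs,
   whose external face is bounded by several walks. *)
Section ExternalNodes.

Variables (V : finType) (E : {set {set V}}) (k : nat) (x : 'I_k -> V).

Definition dangling_graph : rel (option V) := fun a b =>
  match a, b with
  | Some u, Some v => [set u; v] \in E
  | Some u, None => u \in codom x
  | None, Some v => v \in codom x
  | None, None => false
  end.

(* The counterclockwise order in the plane is the clockwise order around the
   point at infinity, hence the decreasing indices. *)
Definition plane_with_external_nodes : Prop :=
  exists s : {perm option V * option V},
    plane_rotation dangling_graph s /\
    (forall i : 'I_k, s (None, Some (x (ordS i))) = (None, Some (x i))).

End ExternalNodes.

Section Matchgates.

Variable C : comNzRingType.

(* The edges are the two-element sets of vertices in mg_edges; the values of
   mg_weight on other sets are irrelevant. *)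
Record matchgate (k : nat) := Matchgate {
  mg_vertex : finType;
  mg_edges : {set {set mg_vertex}};
  mg_weight : {set mg_vertex} -> C;
  mg_external : 'I_k -> mg_vertex;
  mg_edges_card2 : forall A, A \in mg_edges -> #|A| = 2%N;
  mg_external_inj : injective mg_external;
  mg_plane : plane_with_external_nodes mg_edges mg_external
}.

(* The perfect matchings of G[S] are the partitions of S into edges. *)
Definition perf_match (V : finType) (E : {set {set V}}) (w : {set V} -> C)
    (S : {set V}) : C :=
  \sum_(P : {set {set V}} | (P \subset E) && partition P S)
     \prod_(A in P) w A.

Definition matchgate_sig (k : nat) (G : matchgate k)
    (b : {ffun 'I_k -> bool}) : C :=
  let Z := [set mg_external G i | i : 'I_k & b i] in
  perf_match (mg_edges G) (@mg_weight k G) (~: Z).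

Definition matchgate_realizable (k : nat) (f : {ffun 'I_k -> bool} -> C) :
    Prop :=
  exists G : matchgate k, forall b, matchgate_sig G b = f b.

Definition equality_sig (n q : nat) (x : {ffun 'I_n -> 'I_q}) : C :=
  if [forall i, forall j, x i == x j] then 1 else 0.

(* The product of f, seen as a row vector indexed by [q]^n, with the n-th tensor
   power of M, whose (x, y) entry is the product of the M (x_j) (y_j). *)
Definition transform_sig (n q m : nat) (f : {ffun 'I_n -> 'I_q} -> C)
    (M : 'M[C]_(q, m)) (y : {ffun 'I_n -> 'I_m}) : C :=
  \sum_(x : {ffun 'I_n -> 'I_q}) f x * \prod_(j < n) M (x j) (y j).

End Matchgates.

(* The number with binary digits b_0 b_1 ... b_(l-1), b_0 most significant. *)
Fixpoint bits_val (b : seq bool) : nat :=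
  if b is c :: b' then (c * 2 ^ size b' + bits_val b')%N else 0%N.

Lemma bits_val_lt (b : seq bool) : (bits_val b < 2 ^ size b)%N.
Proof.
elim: b => [|c b IHb] //=; rewrite expnS mul2n -addnn.
by case: c; rewrite ?mul1n ?mul0n ?add0n ?ltn_add2l // ltn_addl.
Qed.

Lemma bits_index_proof (l : nat) (b : l.-tuple bool) : (bits_val b < 2 ^ l)%N.
Proof. by rewrite -[l in (_ < 2 ^ l)%N](size_tuple b) bits_val_lt. Qed.

Definition bits_index (l : nat) (b : l.-tuple bool) : 'I_(2 ^ l) :=
  Ordinal (bits_index_proof b).

(* A string of n * l bits as n consecutive blocks of l bits: bit i of block j
   is bit j * l + i of the string. *)
Definition blocks (n l : nat) (b : {ffun 'I_(n * l) -> bool}) :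
    {ffun 'I_n -> 'I_(2 ^ l)} :=
  [ffun j => bits_index [tuple b (mxtens_index (j, i)) | i < l]].

Definition boolean_transform_sig (C : comNzRingType) (n q l : nat)
    (f : {ffun 'I_n -> 'I_q} -> C) (M : 'M[C]_(q, 2 ^ l))
    (b : {ffun 'I_(n * l) -> bool}) : C :=
  transform_sig f M (blocks b).

(* Main.v *)
(**
  Matchgate signatures satisfy quadratic identities.  For bit strings b, c of
  length k differing on D, the sum over j in D of
  (-1)^#{i in D | i < j} Sig(b + e_j) Sig(c + e_j) vanishes.  Superposing a
  matching for b + e_j with one for c + e_j, the component of the external node
  x_j is a path ending at another x_j' with j' in D, and exchanging the two
  matchings along this path is an involution of the terms.  It reverses the
  sign because disjoint paths cannot cross: closing the path at infinity
  gives a cycle, which by Euler's formula is modulo 2 a sum of faces, so that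
  the faces are 2-coloured with the colour changing exactly across the cycle,
  and the other paths pair off the indices of D between j and j'.

  Write the transformed Equality as a sum over a of the n-th tensor powers of
  v_a, and let u_D = v_a (x) v_b for D = (a, b).  If lambda is the operator of
  the identity on one block and P the sign (-1)^(distance of the two strings),
  the identity reads sum_D sum_i (P u_D)^(i) (x) lambda u_D (x) u_D^(n-1-i) = 0.
  As n >= 3, the last factors can be contracted with vectors dual to the u_D,
  which isolates a single D and shows that lambda u_D vanishes at all pairs of
  strings of even distance.  Hence lambda kills v_a^p (x) v_b^p, where v^p is
  the part of v of parity p.  But lambda (v (x) v) = lambda (v (x) w) = 0 forces
  w to be a multiple of v, so the v_a^p are proportional for each p, and the
  v_a span a space of dimension at most 2.
*)

Require Import Defs.
From mathcomp Require Import all_boot all_order all_fingroup all_algebra.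
From mathcomp Require Import reals zify ring.
From mathcomp.real_closed Require Import complex mxtens.

Set Implicit Arguments.
Unset Strict Implicit.
Unset Printing Implicit Defensive.

Import GRing.Theory Num.Theory.

(** * Two matchings superposed *)

Lemma dvdn_lt_double m n : 0 < n < m.*2 -> m %| n -> n = m.
Proof.
move=> /andP[n0 nm] /dvdnP[[|[|k]] e]; move: n0 nm; rewrite e ?mul1n //.
by rewrite -mul2n ltn_mul2r ltnNge /= andbF.
Qed.

(** * Orbits of the composition of two involutions *)

Section InvolutionOrbit.

Variables (T : finType) (f g : T -> T) (x : T).
Hypotheses (fK : involutive f) (gK : involutive g).
Hypotheses (gx : g x = x) (fx : f x != x).

Let t := f \o g.
Local Notation order := fingraph.order.

Let t_inj : injective t.
Proof. by apply: inj_comp; apply: inv_inj. Qed.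

Let iter_t_inj n : injective (iter n t).
Proof. by elim: n => // n IHn y z /t_inj /IHn. Qed.

Lemma dvdn_order n : iter n t x = x -> order t x %| n.
Proof.
have iterm k : iter (k * order t x) t x = x.
  by elim: k => // k IHk; rewrite mulSn iterD IHk iter_order.
rewrite {1}(divn_eq n (order t x)) addnC iterD iterm => e.
have lt_m : n %% order t x < order t x by rewrite ltn_mod fingraph.order_gt0.
by rewrite /dvdn -(findex_iter lt_m) e findex0.
Qed.

(** The dihedral relation: conjugation by the involution [g] turns [t], which is [f] after [g], into
    its inverse. *)
Lemma iter_conj i y : iter i t (g (iter i t y)) = g y.
Proof.
elim: i y => // i IHi y; rewrite iterS (iterSr i t y) IHi.
by rewrite /t /= gK fK.
Qed.

(* The orbit of [x] under [f \o g] is a path with one end [x], fixed by [g];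
   the other end is half-way around the orbit, fixed by [g] or [f] according to
   whether its length is even or odd. *)
Definition opposite_end := iter (uphalf (order t x)) t x.

Lemma orbit_order_gt1 : 1 < order t x.
Proof.
rewrite ltn_neqAle fingraph.order_gt0 andbT eq_sym; apply: contraNneq fx => m1.
by have := iter_order t_inj x; rewrite m1 /= /t /= gx => ->.
Qed.


Lemma uphalf_order : 0 < uphalf (order t x) < order t x.
Proof. by have := orbit_order_gt1; rewrite uphalfE; lia. Qed.

Lemma opposite_end_neq : opposite_end != x.
Proof.
have /andP[h0 hm] := uphalf_order; apply/eqP => e.
have := findex_iter hm; rewrite -/opposite_end e findex0 => h.
by rewrite -h in h0.
Qed.

Lemma opposite_end_fixed : f opposite_end = opposite_end \/ g opposite_end =
  opposite_end.
Proof.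
rewrite /opposite_end; set i := uphalf _; set y := iter i t x.
have gy : iter i t (g y) = x by rewrite iter_conj.
(* It suffices to compare [y] and [g y] after applying [iter i t]. This sends [g y] to [x] by [gy],
   and [y] to [x] or to [t x] according to whether the order is even or odd. *)
have /orP[/eqP e|/eqP e] : (i + i == order t x) || (i + i == (order t x).+1).
- by rewrite /i uphalfE; lia.
- right; apply: (@iter_t_inj i); rewrite -/y gy.
  by rewrite /y -iterD e iter_order.
left; have : t (g y) = y; last by rewrite /t /= gK.
apply: (@iter_t_inj i); rewrite -iterSr iterS gy /y -iterD e iterS.
by rewrite iter_order.
Qed.

(** Let m be the order and 0 < i < m. By [iter_conj], if [g] fixes [iter i t x] then m divides 2i,
    and if [f] does then m divides 2i - 1. Both numbers lie strictly between 0 and 2m, so one of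
    them equals m and i is [uphalf] m. *)
Lemma orbit_fixed y : fconnect t x y -> f y = y \/ g y = y ->
  y = x \/ y = opposite_end.
Proof.
move=> xy; have lti := findex_max xy; rewrite -(iter_findex xy).
move: (findex t x y) lti => [|i] lti fix_y; [by left | right].
rewrite /opposite_end; congr (iter _ t x).
have gy : iter i.+1 t (g (iter i.+1 t x)) = x by rewrite iter_conj.
case: fix_y => e; last first.
  move: gy; rewrite e -iterD => /dvdn_order /dvdn_lt_double.
  by rewrite uphalfE; lia.
have {}e : iter i.+1 t (iter i.+1 t x) = t x.
  have ty : t (g (iter i.+1 t x)) = iter i.+1 t x by rewrite -[RHS]e /t /= gK.
  by rewrite -[in X in iter _ _ X]ty -iterSr iterS gy.
have : iter (i + i.+1) t x = x by apply: t_inj;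
  rewrite -[LHS]iterS -addSn iterD e.
by move=> /dvdn_order /dvdn_lt_double; rewrite uphalfE; lia.
Qed.

Lemma fconnect_g y : fconnect t x y -> fconnect t x (g y).
Proof.
move=> /iter_findex <-; elim: (findex t x y) => [|i IHi];
  first by rewrite /= gx.
apply: connect_trans IHi _; rewrite (fconnect_sym t_inj).
have -> : g (iter i t x) = t (g (iter i.+1 t x)) by rewrite iterS /t /= gK fK.
exact: fconnect1.
Qed.

Lemma fconnect_f y : fconnect t x y -> fconnect t x (f y).
Proof.
by move=> /fconnect_g /connect_trans; apply; have := fconnect1 t (g y);
  rewrite /t /= gK.
Qed.

End InvolutionOrbit.

(** * A perfect matching as an involution of the vertices *)

Section Partner.

Variables (V : finType) (P : {set {set V}}) (S : {set V}).
Hypotheses (PS : partition P S) (P2 : forall A, A \in P -> #|A| = 2).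

(** The default [v] makes the vertices outside [S] the fixed points of the involution. *)
Definition partner v := odflt v [pick u | [set v; u] \in P].

Lemma block_neq v u : [set v; u] \in P -> v != u.
Proof. by move=> /P2; rewrite cards2; case: (v != u). Qed.

Lemma block_uniq v A B : A \in P -> B \in P -> v \in A -> v \in B -> A = B.
Proof.
case/and3P: PS => _ tP _ AP BP vA vB.
by rewrite -(def_pblock tP AP vA) -(def_pblock tP BP vB).
Qed.

Lemma block_sub A : A \in P -> A \subset S.
Proof. by case/and3P: PS => /eqP<- _ _; apply: bigcup_sup. Qed.

Lemma partner_block v u : [set v; u] \in P -> partner v = u.
Proof.
move=> uP; rewrite /partner; case: pickP => [w wP|/(_ u)]; last by rewrite uP.
have : u \in [set v; w].
  by rewrite (block_uniq wP uP (v := v)) ?set21 // set22.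
by rewrite !inE [u == v]eq_sym (negPf (block_neq uP)) => /eqP.
Qed.

Lemma mem_partner v : v \in S -> [set v; partner v] \in P.
Proof.
move=> vS; have [A AP vA] : exists2 A, A \in P & v \in A.
  by case/and3P: PS => /eqP defS _ _; move: vS; rewrite -defS => /bigcupP[A];
    exists A.
have /cards2P[a [b [ab defA]]] : #|A| == 2 by rewrite P2.
have [u defA'] : exists u, A = [set v; u].
  by move: vA; rewrite defA => /set2P[->|->]; [exists b | exists a;
    rewrite setUC].
rewrite defA' in AP; by rewrite (partner_block AP).
Qed.

Lemma partner_out v : v \notin S -> partner v = v.
Proof.
rewrite /partner; case: pickP => // u /block_sub /subsetP /(_ v).
by rewrite set21 => ->.
Qed.

Lemma partner_neq v : v \in S -> partner v != v.
Proof. by move=> /mem_partner /block_neq; rewrite eq_sym. Qed.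

Lemma partner_id v : (partner v == v) = (v \notin S).
Proof.
by apply/idP/idP => [|/partner_out->//]; apply: contraTN => /partner_neq.
Qed.

Lemma partnerK : involutive partner.
Proof.
move=> v; have [vS|vS] := boolP (v \in S); last by rewrite !partner_out.
by apply: partner_block; rewrite setUC mem_partner.
Qed.

End Partner.

Definition superposition (V : finType) (P Q : {set {set V}}) : rel V :=
  [rel u v | [set u; v] \in P :|: Q].

Lemma superposition_sym (V : finType) (P Q : {set {set V}}) :
  symmetric (superposition P Q).
Proof. by move=> u v; rewrite /superposition /= [[set u; v]]setUC. Qed.

(** These are the vertices where the paths of the superposition of a matching of [S] and one of [T]
    end. *)
Definition half_covered (V : finType) (S T : {set V}) :=
  (S :\: T) :|: (T :\: S).

Lemma half_coveredE (V : finType) (S T : {set V}) v :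
  (v \in half_covered S T) = (v \in S) (+) (v \in T).
Proof. by rewrite !inE; case: (v \in S) (v \in T) => [] []. Qed.

(** The component of [x] is its orbit under the composition of the two partner maps. As [g] fixes
    [x] and [f] moves it, the orbit is a path, and half-covered vertices are those fixed by exactly
    one of the maps. *)
Lemma superposition_end (V : finType) (P Q : {set {set V}}) (S T : {set V}) x :
  partition P S -> partition Q T ->
  (forall A, A \in P -> #|A| = 2) -> (forall A, A \in Q -> #|A| = 2) ->
  x \in S -> x \notin T ->
  exists y, [/\ y \in half_covered S T, y != x,
    connect (superposition P Q) x y &
    forall z, z \in half_covered S T -> connect (superposition P Q) x z ->
      z = x \/ z = y].
Proof.
move=> PS QT P2 Q2 Sx Tx; pose f := partner P; pose g := partner Q.
have fK : involutive f := partnerK PS P2;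
  have gK : involutive g := partnerK QT Q2.
have gx : g x = x := partner_out QT Tx;
  have fx : f x != x := partner_neq PS P2 Sx.
have fid v : (f v == v) = (v \notin S) := partner_id PS P2 v.
have gid v : (g v == v) = (v \notin T) := partner_id QT Q2 v.
have conn z : connect (superposition P Q) x z -> fconnect (f \o g) x z.
  case/connectP => p hp ->; elim/last_ind: p hp => [|p v IHp];
    first by rewrite connect0.
  rewrite rcons_path last_rcons => /andP[/IHp xp];
    rewrite /superposition /= inE.
  case/orP=> [/(partner_block PS P2)|/(partner_block QT Q2)] <-.
    exact: fconnect_f.
  exact: fconnect_g.
have hf v : connect (superposition P Q) v (f v).
  rewrite /f; have [/(mem_partner PS P2) vP|/(partner_out PS) ->] :=
    boolP (v \in S); last exact: connect0.
  by apply: connect1; rewrite /superposition /= inE vP.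
have hg v : connect (superposition P Q) v (g v).
  rewrite /g; have [/(mem_partner QT Q2) vP|/(partner_out QT) ->] :=
    boolP (v \in T); last exact: connect0.
  by apply: connect1; rewrite /superposition /= inE vP orbT.
have conn' z : fconnect (f \o g) x z -> connect (superposition P Q) x z.
  move/iter_findex <-; elim: findex => [|i IHi]; first exact: connect0.
  by apply: connect_trans IHi _; apply: connect_trans (hg _) (hf _).
pose y := opposite_end f g x; have yx : y != x := opposite_end_neq fK gK gx fx.
have xy : fconnect (f \o g) x y := fconnect_iter _ _ _.
have hc z : z \in half_covered S T -> f z = z \/ g z = z.
  rewrite half_coveredE => e.
  have /orP : (f z == z) || (g z == z) by rewrite fid gid;
    case: (_ \in S) e => // ->.
  by case=> /eqP; [left | right].
exists y; split=> //.
- rewrite half_coveredE -[y \in S]negbK -[y \in T]negbK -fid -gid.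
  have : (f y == y) || (g y == y).
    by apply/orP; have [->|->] := opposite_end_fixed fK gK gx fx; [left|right].
  (* A vertex fixed by both maps would be alone in its orbit, hence equal to [x]. *)
  have : ~~ ((f y == y) && (g y == y)).
    apply: contra yx => /andP[/eqP fy /eqP gy].
    have : fconnect (f \o g) y x by rewrite (fconnect_sym (inj_comp (inv_inj
      fK) (inv_inj gK))).
    by move=> /iter_findex <-; elim: findex => //= i /eqP<-; rewrite gy fy.
  by case: (f y == y) (g y == y) => [] [].
- exact: conn'.
by move=> z /hc zfix /conn xz; apply: (orbit_fixed fK gK gx fx xz zfix).
Qed.

Lemma half_covered_end (V : finType) (P Q : {set {set V}}) (S T : {set V}) x :
  partition P S -> partition Q T ->
  (forall A, A \in P -> #|A| = 2) -> (forall A, A \in Q -> #|A| = 2) ->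
  x \in half_covered S T ->
  exists y, [/\ y \in half_covered S T, y != x,
    connect (superposition P Q) x y &
    forall z, z \in half_covered S T -> connect (superposition P Q) x z ->
      z = x \/ z = y].
Proof.
move=> PS QT P2 Q2; rewrite !inE => /orP[]/andP[] => [Tx Sx|Sx Tx].
  exact: superposition_end.
have hC : half_covered S T = half_covered T S by rewrite /half_covered setUC.
have cC : connect (superposition P Q) =2 connect (superposition Q P).
  by apply: eq_connect => u v; rewrite /superposition /= [P :|: Q]setUC.
rewrite hC; have [y [hy yx xy yz]] := superposition_end QT PS Q2 P2 Tx Sx.
exists y; split=> // [|z]; rewrite cC //; exact: yz.
Qed.

(** * Cycles of a plane graph bound faces *)

(** Each fibre of [g] on [A] is a translate of the kernel of [g] in [A]. *)
Lemma card_additive_im (X Y : finType) (g : {ffun X -> bool} -> {ffun Y ->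
  bool})
    (A : {set {ffun X -> bool}}) :
  {morph g : u v / (u - v)%R} -> {in A &, forall u v, (u - v)%R \in A} ->
  #|A| = #|g @: A| * #|[set u in A | g u == 0%R]|.
Proof.
move=> gB AB; have A0 u : u \in A -> 0%R \in A by move=> Au;
  rewrite -(subrr u) AB.
have g0 : g 0%R = 0%R by rewrite -(subrr 0%R) gB subrr.
rewrite -sum1_card (partition_big_imset g) /= -sum_nat_const.
apply: eq_bigr => _ /imsetP[u0 Au0 ->].
rewrite sum1dep_card -(card_imset _ (can_inj (subrK u0))).
apply: eq_card => u; apply/imsetP/idP => [[v]|].
  rewrite !inE => /andP[Av /eqP gv] ->; by rewrite AB //= gB gv subrr eqxx.
rewrite inE => /andP[Au /eqP gu]; exists (u + u0)%R; last by rewrite addrK.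
have A_u0 : (- u0)%R \in A by rewrite -sub0r AB // (A0 u0).
rewrite inE; apply/andP; split; first by rewrite -[u0]opprK AB.
by rewrite -subr_eq0 -gB addrK gu.
Qed.

Lemma card_determined (X Y : finType) (S : {set {ffun X -> bool}})
    (B : {set Y}) (pt : Y -> X) :
  {in S &, forall f g : {ffun X -> bool}, {in B, forall y,
    f (pt y) = g (pt y)} -> f = g} ->
  (#|S| <= 2 ^ #|B|)%N.
Proof.
move=> detS; rewrite -card_powerset.
pose h (f : {ffun X -> bool}) := [set y in B | f (pt y)].
rewrite -(card_in_imset (f := h)) => [|f g Sf Sg /setP efg]; last first.
  by apply: detS => // y By; have := efg y; rewrite !inE By.
by apply/subset_leq_card/subsetP => _ /imsetP[f _ ->];
rewrite inE; apply/subsetP => y; rewrite inE => /andP[].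
Qed.

Lemma card_separating (X Y : finType) (S : {set {ffun X -> bool}})
    (B : {set Y}) (pt : Y -> X) :
  (forall B' : {set Y}, B' \subset B ->
     exists2 f : {ffun X -> bool}, f \in S & {in B, forall y,
       f (pt y) = (y \in B')}) ->
  (2 ^ #|B| <= #|S|)%N.
Proof.
move=> sepS; rewrite -card_powerset.
pose h (f : {ffun X -> bool}) := [set y in B | f (pt y)].
apply: leq_trans (leq_imset_card h S).
apply/subset_leq_card/subsetP => B'; rewrite inE => sB'.
have [f Sf fB'] := sepS _ sB'; apply/imsetP; exists f => //.
apply/setP=> y; rewrite inE; case By: (y \in B); first by rewrite fB'.
by apply/negP => /(subsetP sB'); rewrite By.
Qed.

(** [B] takes from each pair [x], [g x] the element of smaller [enum_rank]. *)
Lemma fixfree_involution_half (X : finType) (A : {set X}) (g : X -> X) :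
  {in A, forall x, [/\ g x \in A, g (g x) = x & g x != x]} ->
  exists B : {set X}, [/\ #|A| = #|B|.*2, B \subset A &
    {in A, forall x, (x \in B) || (g x \in B)}].
Proof.
move=> gA; pose B := [set x in A | (enum_rank x < enum_rank (g x))%N].
have sBA : B \subset A by apply/subsetP => x; rewrite inE => /andP[].
have ABg : {in A, forall x, (g x \in B) = (x \notin B)}.
  move=> x Ax; have [gAx ggx gx] := gA x Ax.
  rewrite !inE Ax gAx ggx /= -leqNgt [RHS]leq_eqVlt.
  suff /negPf-> : (enum_rank (g x) : nat) != enum_rank x by [].
  by apply: contra gx => /eqP/val_inj/enum_rank_inj->.
exists B; split=> // [|x Ax]; last by rewrite ABg // orbN.
rewrite -(cardsID B A) (setIidPr sBA) -addnn; congr addn.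
have injg : {in B &, injective g}.
  move=> x y /(subsetP sBA) /gA[_ gx _] /(subsetP sBA) /gA[_ gy _] e.
  by rewrite -gx e gy.
rewrite -(card_in_imset injg); apply: eq_card => x; apply/setDP/imsetP.
  case=> Ax /negPf nBx; exists (g x); last by case: (gA x Ax).
  by rewrite ABg // nBx.
case=> y By ->; have Ay := subsetP sBA _ By; have [gAy ggy _] := gA y Ay.
by split=> //; rewrite ABg // By.
Qed.

(** * Chains modulo 2: the dimension count behind Euler's formula *)

Section PlanePotential.

Local Open Scope ring_scope.

Variables (T : finType) (r : rel T) (s : {perm T * T}).
Hypotheses (r_sym : symmetric r) (r_irr : irreflexive r).
Hypothesis rot_s : rotation_system r s.

Local Notation A := (darts r).
Local Notation F := (face_next s).
Local Notation rev := (@dart_rev T).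

Lemma dart_revK : involutive rev. Proof. by case. Qed.

Lemma mem_dart_rev d : (rev d \in A) = (d \in A).
Proof. by rewrite !inE r_sym. Qed.

Lemma rotation_dart d : d \in A -> s d \in A /\ (s d).1 = d.1.
Proof.
by move=> Ad; move: (fconnect1 s d); rewrite rot_s // => /andP[-> /eqP].
Qed.

Lemma mem_rotation d : (s d \in A) = (d \in A).
Proof.
apply/idP/idP => [Asd|/rotation_dart[]//].
have := rot_s Asd d; rewrite fconnect_sym ?fconnect1; last exact: perm_inj.
by case/esym/andP.
Qed.

Lemma face_next_inj : injective F.
Proof. by move=> d d' /perm_inj /(inv_inj dart_revK). Qed.

Lemma mem_face_next d : (F d \in A) = (d \in A).
Proof. by rewrite mem_rotation mem_dart_rev. Qed.

(** Sets of edges as vectors over the field of two elements; on [bool], subtraction is exclusive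
    or. *)
Definition edge_chains : {set {ffun T * T -> bool}} :=
  [set c : {ffun T * T -> bool} | [forall d,
    (c d ==> (d \in A)) && (c (rev d) == c d)]].

(** Sets of faces, encoded as functions of the darts that are constant along boundary walks. The
    value off the darts is fixed to [false] so that cardinals count only faces. *)
Definition face_colorings : {set {ffun T * T -> bool}} :=
  [set phi : {ffun T * T -> bool} | [forall d,
    (phi d ==> (d \in A)) && (phi (F d) == phi d)]].

Definition chain_boundary (c : {ffun T * T -> bool}) : {ffun T -> bool} :=
  [ffun v => \sum_u c (v, u)].

(** The darts [d] and [rev d] belong to the faces on the two sides of an edge, so this is the
    boundary modulo 2 of a set of faces. *)
Definition face_boundary (phi : {ffun T * T -> bool}) : {ffun T * T -> bool} :=
  [ffun d => phi d - phi (rev d)].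

Definition cycles := [set c in edge_chains | chain_boundary c == 0%R].

Lemma edge_chainsP (c : {ffun T * T -> bool}) :
  reflect (forall d, (c d -> d \in A) /\ c (rev d) = c d) (c \in edge_chains).
Proof.
rewrite inE; apply: (iffP forallP) => [h d|h d].
  by have /andP[/implyP ? /eqP] := h d.
by have [/implyP-> ->] := h d; rewrite eqxx.
Qed.

Lemma face_coloringsP (phi : {ffun T * T -> bool}) :
  reflect (forall d, (phi d -> d \in A) /\ phi (F d) = phi d)
          (phi \in face_colorings).
Proof.
rewrite inE; apply: (iffP forallP) => [h d|h d].
  by have /andP[/implyP ? /eqP] := h d.
by have [/implyP-> ->] := h d; rewrite eqxx.
Qed.

Lemma chain_boundaryB : {morph chain_boundary : c c' / c - c'}.
Proof.
move=> c c'; apply/ffunP => v; rewrite !ffunE -sumrB.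
by apply: eq_bigr => u _; rewrite !ffunE.
Qed.

Lemma face_boundaryB : {morph face_boundary : c c' / c - c'}.
Proof.
by move=> c c'; apply/ffunP => d; rewrite !ffunE opprD addrACA -opprD.
Qed.

Lemma edge_chainsB : {in edge_chains &, forall c c', c - c' \in edge_chains}.
Proof.
move=> c c' /edge_chainsP hc /edge_chainsP hc'; apply/edge_chainsP => d.
have [hd rd] := hc d; have [hd' rd'] := hc' d; rewrite !ffunE rd rd'.
by split=> //; case: (c d) hd => [hd _|_];
  [exact: hd | case: (c' d) hd' => // hd' _; exact: hd'].
Qed.

Lemma face_coloringsB :
  {in face_colorings &, forall c c', c - c' \in face_colorings}.
Proof.
move=> c c' /face_coloringsP hc /face_coloringsP hc';
  apply/face_coloringsP => d.
have [hd rd] := hc d; have [hd' rd'] := hc' d; rewrite !ffunE rd rd'.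
by split=> //; case: (c d) hd => [hd _|_];
  [exact: hd | case: (c' d) hd' => // hd' _; exact: hd'].
Qed.

Lemma darts_half : exists2 B : {set T * T}, #|A| = #|B|.*2 &
  {in A, forall d, (d \in B) || (rev d \in B)}.
Proof.
have [|B [cA sB BA]] := @fixfree_involution_half _ A rev; last by exists B.
case=> u v Ad; rewrite mem_dart_rev Ad dart_revK; split=> //.
by apply: contraTneq Ad => -[-> _]; rewrite inE r_irr.
Qed.

Lemma card_edge_chains : (#|edge_chains| <= 2 ^ #|A|./2)%N.
Proof.
have [B -> BA] := darts_half; rewrite doubleK.
apply: (@card_determined _ _ _ B id) =>
  c c' /edge_chainsP hc /edge_chainsP hc' e.
apply/ffunP => d; have [hd rd] := hc d; have [hd' rd'] := hc' d.
have [/BA/orP[/e //|/e]|nAd] := boolP (d \in A); first by rewrite rd rd'.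
by rewrite (contraNF hd nAd) (contraNF hd' nAd).
Qed.

Lemma card_face_colorings : (2 ^ fcard F A <= #|face_colorings|)%N.
Proof.
have Fsym := fconnect_sym face_next_inj.
have clA : fclosed F A by move=> d _ /eqP<-; rewrite mem_face_next.
pose B := [set d | froots F d & d \in A].
have -> : fcard F A = #|B| by apply: eq_card => d; rewrite !inE.
apply: (@card_separating _ _ _ B id) => B' sB'.
exists [ffun d => froot F d \in B'] => [|d]; last first.
  by rewrite inE => /andP[/eqP rd _]; rewrite ffunE rd.
apply/face_coloringsP => d; rewrite !ffunE; split.
  move=> /(subsetP sB'); rewrite inE => /andP[_].
  by rewrite -(closed_connect clA (connect_root _ d)).
by congr (_ \in B'); apply/eqP; rewrite root_connect // Fsym fconnect1.
Qed.


Definition some_dart (v : T) : T * T := (v, odflt v [pick u | r v u]).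

Lemma some_dartP u v : r u v -> some_dart u \in A.
Proof.
by rewrite inE /some_dart; case: pickP => [w //|/(_ v) /= ->].
Qed.

(** When the boundary is zero, [phi] is invariant under [rev] and [F], hence under [s], since [s d]
    is [F (rev d)]. It is thus constant around each vertex, then across each edge, and so on each
    component. *)
Lemma face_kernel_const (phi : {ffun T * T -> bool}) :
  phi \in face_colorings -> face_boundary phi = 0 ->
  forall d, d \in A -> phi d = phi (some_dart (fingraph.root r d.1)).
Proof.
move=> /face_coloringsP Fphi /ffunP phi0.
have revphi d : phi (rev d) = phi d.
  by have := phi0 d; rewrite !ffunE => /subr0_eq.
have sphi d : phi (s d) = phi d.
  by have [_] := Fphi (rev d); rewrite /face_next dart_revK revphi.
have vphi d d' : d \in A -> d' \in A -> d'.1 = d.1 -> phi d = phi d'.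
  move=> Ad Ad' e; apply: (@fconnect_invariant _ s _ phi) => [d0|].
    by apply/eqP; rewrite sphi.
  by rewrite rot_s // Ad' e eqxx.
have rphi u v : r u v -> phi (some_dart u) = phi (some_dart v).
  move=> ruv; have rvu : r v u by rewrite r_sym.
  rewrite (vphi _ (u, v)) ?(some_dartP ruv) ?inE //.
  by rewrite -revphi (vphi _ (some_dart v)) ?(some_dartP rvu) ?inE.
move=> [u v] Ad; have ruv : r u v by rewrite inE in Ad.
rewrite (vphi _ (some_dart u)) ?(some_dartP ruv) //=.
have /connectP[p rp ->] := connect_root r u.
elim: p {v ruv Ad} u rp => //= v p IHp u /andP[ruv rp].
by rewrite (rphi _ _ ruv) IHp.
Qed.

Lemma card_face_kernel :
  (#|[set phi in face_colorings | face_boundary phi == 0%R]|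
     <= 2 ^ n_comp r (nonisolated r))%N.
Proof.
have rsym := sym_connect_sym r_sym.
pose B := [set v | roots r v & v \in nonisolated r].
have -> : n_comp r (nonisolated r) = #|B| by apply: eq_card => v; rewrite !inE.
apply: (@card_determined _ _ _ B some_dart) => f g.
move=> /setIdP[Cf /eqP f0] /setIdP[Cg /eqP g0] efg.
apply/ffunP => d; have [Ad|nAd] := boolP (d \in A); last first.
  have [hf _] := face_coloringsP _ Cf d; have [hg _] := face_coloringsP _ Cg d.
  by rewrite (contraNF hf nAd) (contraNF hg nAd).
rewrite (face_kernel_const Cf) // (face_kernel_const Cg) // efg // !inE
  roots_root //=.
have rd : r d.1 d.2 by rewrite inE in Ad.
have /connectP[p rp ->] := connect_root r d.1.
elim: p d.1 d.2 rd rp {Ad} => [u v ruv _|w p IHp u v ruv] /=.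
  by apply/existsP; exists v.
by case/andP=> ruw; apply: (IHp w u); rewrite r_sym.
Qed.

(** At a vertex the boundary is the difference of the sums of [phi d] and of [phi (rev d)] over the
    outgoing darts. The rotation [s] permutes these darts, and [phi (s d) = phi (rev d)], so the
    sums agree. *)
Lemma face_boundary_cycle (phi : {ffun T * T -> bool}) :
  phi \in face_colorings -> face_boundary phi \in cycles.
Proof.
move=> /face_coloringsP Fphi; apply/setIdP; split.
  apply/edge_chainsP => d; rewrite !ffunE dart_revK; split; last first.
    by case: (phi d) (phi (rev d)) => [] [].
  have [hd _] := Fphi d; have [hrd _] := Fphi (rev d).
  by rewrite mem_dart_rev in hrd;
    case: (phi d) (phi (rev d)) hd hrd => [] [] // => [->|_ ->].
apply/eqP/ffunP => v; rewrite !ffunE.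
under eq_bigr do rewrite ffunE.
rewrite sumrB.
have phi_out u w : ~~ r u w -> phi (u, w) = 0.
  by move=> nr; apply/negbTE; apply: contra nr => /(proj1 (Fphi _));
    rewrite inE.
have vsum (psi : T * T -> bool) : (forall d, d \notin A -> psi d = 0) ->
    \sum_u psi (v, u) = \sum_(d | (d \in A) && (d.1 == v)) psi d.
  move=> psi0; rewrite (bigID (r v)) /= [X in _ + X]big1 ?addr0 => [|u nr];
    last first.
    by rewrite psi0 // inE.
  rewrite (reindex_onto (fun u => (v, u)) snd) /=;
    last by move=> [? ?] /= /andP[_ /eqP->].
  by apply: eq_bigl => u; rewrite !inE !eqxx !andbT.
rewrite vsum => [|[u w]]; last by rewrite inE => /phi_out.
rewrite (vsum (phi \o rev)) => [|[u w]]; last first.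
  by rewrite inE r_sym => /phi_out.
rewrite (reindex_inj (@perm_inj _ s)) /=.
have sv d : (s d \in A) && ((s d).1 == v) = (d \in A) && (d.1 == v).
  rewrite mem_rotation; case Ad: (d \in A) => //=.
  by have [_ ->] := rotation_dart Ad.
rewrite (eq_bigl _ _ sv) -sumrB big1 // => d _.
by have [_ <-] := Fphi (rev d); rewrite /face_next dart_revK subrr.
Qed.

(** A path from [v] to the root of its component has boundary [v] plus the root. Sums of such paths
    realize every prescribed boundary on the non-root vertices. *)
Lemma chain_boundary_ge :
  (2 ^ #|nonisolated r| <=
     #|chain_boundary @: edge_chains| * 2 ^ n_comp r (nonisolated r))%N.
Proof.
have rsym := sym_connect_sym r_sym.
pose N := nonisolated r; pose B := N :\: [set v | roots r v].
have -> : #|N| = (#|B| + n_comp r N)%N.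
  rewrite -(cardsID [set v | roots r v] N) addnC; congr addn.
  by apply: eq_card => v; rewrite !inE andbC.
rewrite expnD leq_mul2r; apply/orP; right.
have ex_path v : exists2 c, c \in edge_chains &
    chain_boundary c = [ffun u => (u == v) (+) (u == fingraph.root r v)].
  have /connectP[p rp ->] := connect_root r v.
  elim: p v rp => [|w p IHp] v /=.
    exists 0; first by apply/edge_chainsP => d; rewrite !ffunE.
    by apply/ffunP => u; rewrite !ffunE addbb big1 // => x _; rewrite ffunE.
  case/andP=> rvw /IHp[c Cc dc].
  pose e : {ffun T * T -> bool} := [ffun d => (d == (v, w)) || (d == (w, v))].
  have Ce : e \in edge_chains.
    apply/edge_chainsP => -[x y]; rewrite !ffunE !xpair_eqE; split.
      by move=> /orP[] /andP[/eqP-> /eqP->]; rewrite inE //= r_sym.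
    by rewrite orbC andbC [in X in _ || X]andbC.
  have Ce' : - e \in edge_chains.
    by rewrite -sub0r edge_chainsB //; apply/edge_chainsP => d; rewrite !ffunE.
  (* The edge is added as a double difference because [edge_chainsB] gives closure under
     subtraction. *)
  exists (c - - e); first exact: edge_chainsB.
  have d0 : chain_boundary 0 = 0 by rewrite -(subrr 0) chain_boundaryB !subrr.
  rewrite chain_boundaryB -[- e]sub0r chain_boundaryB dc d0 sub0r opprK.
  apply/ffunP => u; rewrite !ffunE.
  have vw : v != w by apply: contraTneq rvw => ->; rewrite r_irr.
  have -> : \sum_x e (u, x) = (u == v) (+) (u == w).
    under eq_bigr do rewrite ffunE !xpair_eqE.
    have [->|uv] := eqVneq u v.
      rewrite (negPf vw) addbF (bigD1 w) //= eqxx big1 // => x /negPf xw.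
      by rewrite xw.
    have [_|uw] := eqVneq u w; last by rewrite big1.
    by rewrite (bigD1 v) //= eqxx big1 // => x /negPf xv; rewrite xv.
  by do !case: (_ == _).
apply: (@card_separating _ _ _ B id) => B' sB'.
have [c Cc dc] : exists2 c, c \in edge_chains & {in B, forall v,
  chain_boundary c v = (v \in B')}.
  have : {subset enum B' <= B} by move=> v; rewrite mem_enum; apply: subsetP.
  have eB' v : (v \in B') = (v \in enum B') by rewrite mem_enum.
  have := enum_uniq B'.
  suff H (l : seq T) : uniq l -> {subset l <= B} -> exists2 c,
    c \in edge_chains &
      {in B, forall v, chain_boundary c v = (v \in l)}.
    by move=> u sl; have [c Cc dc] := H _ u sl; exists c => // v /dc->;
      rewrite -eB'.
  elim: l => [_ _|v l IHl /= /andP[nvl ul] sl].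
    exists 0; first by apply/edge_chainsP => d; rewrite !ffunE.
    by move=> u _; rewrite !ffunE big1 // => x _; rewrite ffunE.
  have [|c Cc dc] := IHl ul; first by move=> u lu; rewrite sl ?inE ?lu ?orbT.
  have [c' Cc' dc'] := ex_path v.
  exists (c - c'); first exact: edge_chainsB.
  move=> u Bu; have := dc u Bu; rewrite chain_boundaryB dc' inE !ffunE => ->.
  have -> : (u == fingraph.root r v) = false.
    by apply: contraTF Bu => /eqP->; rewrite !inE roots_root.
  by have [->|] := eqVneq u v; [rewrite (negPf nvl) | case: (u \in l)].
by exists (chain_boundary c); [apply: imset_f | ].
Qed.

(** One inclusion is [face_boundary_cycle]; the other is a count. With N vertices, E edges, F faces
    and K components, the cycles have dimension at most E - N + K and the face boundaries at least F
    - K, and these bounds agree by Euler's formula. *)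
Theorem cycle_is_face_boundary :
  (#|nonisolated r| + fcard F A =
     #|A|./2 + 2 * n_comp r (nonisolated r))%N ->
  face_boundary @: face_colorings = cycles.
Proof.
move=> euler; apply/eqP; rewrite eqEcard; apply/andP; split.
  by apply/subsetP => _ /imsetP[phi Fphi ->]; apply: face_boundary_cycle.
set N := #|nonisolated r| in euler; set K := n_comp r _ in euler.
have h1 := card_additive_im face_boundaryB face_coloringsB.
have h2 := card_additive_im chain_boundaryB edge_chainsB.
(* Multiplying by this power of 2 lets all the bounds be combined as products, without subtracting
   exponents. *)
rewrite -(leq_pmul2r (expn_gt0 2 (N + fcard F A)%N)).
have := card_face_colorings; rewrite h1 => h3.
have h4 := leq_trans h3 (leq_mul (leqnn _) card_face_kernel).
have := card_edge_chains; rewrite h2 => h5.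
rewrite [in X in (_ <= X)%N]euler mul2n -addnn !expnD.
apply: leq_trans (leq_mul (leqnn _) (leq_mul chain_boundary_ge h4)) _.
rewrite -/K mulnACA !mulnA; do 2 apply: leq_mul => //.
by rewrite mulnC; apply: leq_mul; rewrite // mulnC.
Qed.

End PlanePotential.

(** [phi] colours the face of each dart, and the colour changes exactly across the edges of [c].
    Both values in the conclusion agree because [s d] lies on the face of [dart_rev d]. *)
Lemma plane_cycle_potential (T : finType) (r : rel T) (s : {perm T * T})
    (c : T * T -> bool) :
  symmetric r -> irreflexive r -> plane_rotation r s ->
  (forall d, c d -> r d.1 d.2) -> (forall d, c (dart_rev d) = c d) ->
  (forall v, \big[addb/false]_u c (v, u) = false) ->
  exists phi : T * T -> bool, forall d, r d.1 d.2 ->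
    phi (s d) = phi d (+) c d /\ phi (dart_rev d) = phi d (+) c d.
Proof.
move=> r_sym r_irr [rot_s euler] cr crev c0.
have : finfun c \in cycles r.
  apply/setIdP; split; last first.
    by apply/eqP/ffunP => v; rewrite !ffunE -[RHS](c0 v);
      apply: eq_bigr => u _; rewrite ffunE.
  by apply/edge_chainsP => d; rewrite !ffunE crev; split=> // /cr; rewrite inE.
rewrite -(cycle_is_face_boundary r_sym r_irr rot_s euler).
case/imsetP => phi /face_coloringsP Fphi /ffunP dphi; exists phi => d rd.
have e : phi (dart_rev d) = phi d (+) c d.
  have := dphi d; rewrite !ffunE => ->.
  by case: (phi d) (phi (dart_rev d)) => [] [].
by split=> //; rewrite -e; have [_ <-] := Fphi (dart_rev d);
  rewrite /face_next dart_revK.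
Qed.

(** * Paths between external nodes do not cross *)

Lemma big_option (T : finType) (R : Type) (idx : R) (op : Monoid.com_law idx)
    (F : option T -> R) :
  \big[op/idx]_o F o = op (F None) (\big[op/idx]_t F (Some t)).
Proof.
rewrite (bigD1 None) //=; congr (op _ _).
rewrite (reindex_omap (fun t => Some t) id) /=; last by case.
by apply: eq_bigl => t; rewrite eqxx.
Qed.

Lemma odd_block_sum (V : finType) (P : {set {set V}}) (S : {set V}) u :
  partition P S -> (forall A, A \in P -> #|A| = 2) ->
  \big[addb/false]_v ([set u; v] \in P) = (u \in S).
Proof.
move=> PS P2; have [uS|uS] := boolP (u \in S); last first.
  rewrite big1 // => v _; apply: contraNF uS => /(block_sub PS)/subsetP; apply.
  exact: set21.
rewrite (bigD1 (partner P u)) //= (mem_partner PS P2 uS) big1 // => v.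
by apply: contraNF => /(partner_block PS P2) ->.
Qed.

Lemma odd_card_addb (T : finType) (D : {set T}) (p q : pred T) :
  odd #|[set i in D | p i (+) q i]| =
    odd #|[set i in D | p i]| (+) odd #|[set i in D | q i]|.
Proof.
rewrite -!sum1dep_card !(big_mkcond (fun i => (i \in D) && _)) /=.
rewrite !(big_morph odd oddD erefl) -big_split /=; apply: eq_bigr => i _.
by case: (i \in D) (p i) (q i) => [] [] [].
Qed.

Section NonCrossing.

Variables (V : finType) (E : {set {set V}}) (k : nat) (x : 'I_k -> V).
Hypotheses (E2 : forall A, A \in E -> #|A| = 2) (x_inj : injective x).
Variables (s : {perm option V * option V}).
Hypothesis plane_s : plane_rotation (dangling_graph E x) s.
Hypothesis s_x : forall i, s (None, Some (x (ordS i))) = (None, Some (x i)).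

Variables (P Q : {set {set V}}) (S T : {set V}).
Hypotheses (PE : P \subset E) (QE : Q \subset E).
Hypotheses (PS : partition P S) (QT : partition Q T).

Variable (D : {set 'I_k}).
Hypothesis DST : half_covered S T = x @: D.

Local Notation r := (dangling_graph E x).
Local Notation h := (superposition P Q).

Let P2 A : A \in P -> #|A| = 2. Proof. by move=> /(subsetP PE) /E2. Qed.
Let Q2 A : A \in Q -> #|A| = 2. Proof. by move=> /(subsetP QE) /E2. Qed.

Lemma dangling_sym : symmetric r.
Proof. by move=> [u|] [v|] //=; rewrite setUC. Qed.

Lemma dangling_irr : irreflexive r.
Proof. by case=> //= u; apply/negP => /E2; rewrite cards2 eqxx. Qed.

Let h_sym : connect_sym h.
Proof. by apply: sym_connect_sym; apply: superposition_sym. Qed.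

Variables j j' : 'I_k.
Hypotheses (Dj : j \in D) (Dj' : j' \in D) (jj' : j' != j).
Hypothesis conn_j : connect h (x j) (x j').

(* The path from [x j] to [x j'], closed through the point at infinity.  The sum
   modulo 2 discards edges common to both matchings. *)
Definition path_cycle (d : option V * option V) : bool :=
  match d with
  | (Some u, Some v) =>
     connect h (x j) u && (([set u; v] \in P) (+) ([set u; v] \in Q))
  | (Some u, None) | (None, Some u) => (u == x j) || (u == x j')
  | (None, None) => false
  end.

Lemma component_end u : u \in half_covered S T -> connect h (x j) u ->
  u = x j \/ u = x j'.
Proof.
have hx i : i \in D -> x i \in half_covered S T by rewrite DST; apply: imset_f.
have [y [_ _ _ only]] := half_covered_end PS QT P2 Q2 (hx j Dj).
have [e|->] := only _ (hx j' Dj') conn_j; last exact: only.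
by case/eqP: jj'; apply: x_inj.
Qed.

Lemma path_cycle_edge d : path_cycle d -> r d.1 d.2.
Proof.
case: d => -[u|] [v|] //=; last 2 first.
- by case/orP=> /eqP->; apply: codom_f.
- by case/orP=> /eqP->; apply: codom_f.
case/andP=> _ e; have : ([set u; v] \in P) || ([set u;
  v] \in Q) by case: (_ \in P) e.
by case/orP; apply: subsetP.
Qed.

Lemma path_cycle_rev d : path_cycle (dart_rev d) = path_cycle d.
Proof.
case: d => -[u|] [v|] //=; rewrite [[set v; u]]setUC.
have [e|] := boolP (h u v).
  by rewrite !(h_sym (x j)) (same_connect1 h_sym e).
by rewrite /superposition /= inE negb_or => /andP[/negPf-> /negPf->];
  rewrite !andbF.
Qed.

(** In the component, only [x j] and [x j'] have odd degree in the sum of the matchings, and the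
    dangling edges there correct it. The point at infinity has exactly these two edges. *)
Lemma path_cycle_even v : \big[addb/false]_u path_cycle (v, u) = false.
Proof.
rewrite big_option; case: v => [u|] /=; last first.
  have xjj : x j' != x j by rewrite (inj_eq x_inj).
  rewrite (bigD1 (x j)) //= (bigD1 (x j')) //= !eqxx orbT big1 // => u.
  by case/andP=> /negPf-> /negPf->.
have -> : \big[addb/false]_v (connect h (x j) u &&
     (([set u; v] \in P) (+) ([set u; v] \in Q))) =
   connect h (x j) u && (u \in half_covered S T).
  case: connect => /=; last by rewrite big1.
  by rewrite big_split /= (odd_block_sum _ PS P2) (odd_block_sum _ QT Q2)
    half_coveredE.
apply/negbTE; rewrite negb_add; apply/eqP; apply/idP/idP.
  by case/orP=> /eqP->; rewrite ?conn_j ?connect0 DST imset_f.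
by case/andP=> ju hu; have [->|->] := component_end hu ju; rewrite eqxx ?orbT.
Qed.

(** The component of [x i] avoids the cycle through [x j] and [x j'], so it stays on faces of one
    colour. Around infinity the colour changes exactly at [j] and [j'], so equal colours mean equal
    sides. *)
Lemma same_side i i' : i \in D :\: [set j; j'] -> connect h (x i) (x i') ->
  (j <= i) (+) (j' <= i) = (j <= i') (+) (j' <= i').
Proof.
have [phi phiP] := plane_cycle_potential dangling_sym dangling_irr plane_s
  path_cycle_edge path_cycle_rev path_cycle_even.
pose a i := phi (None, Some (x i)).
have rx i0 : r None (Some (x i0)) by rewrite /= codom_f.
have aS i0 : a i0 = a (ordS i0) (+) ((ordS i0 == j) || (ordS i0 == j')).
  rewrite /a -s_x; have [-> _] := phiP (None, Some (x (ordS i0))) (rx _).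
  by rewrite /= !(inj_eq x_inj).
(* Up to a constant, the colour at a dangling edge is its side: in passing from [m] to [m.+1], both
   change exactly when [m.+1] is [j] or [j']. *)
have a0 i1 i2 : a i1 (+) ((j <= i1) (+) (j' <= i1)) =
  a i2 (+) ((j <= i2) (+) (j' <= i2)).
  suff a1 i0 : forall lt0k : 0 < k, a i0 (+) ((j <= i0) (+) (j' <= i0)) =
      a (Ordinal lt0k) (+) ((j <= 0) (+) (j' <= 0)).
    have lt0k : 0 < k by apply: leq_ltn_trans (ltn_ord j).
    by rewrite !(a1 _ lt0k).
  move=> lt0k; case: i0 => m; elim: m => [|m IHm] lt_mk.
    by congr (a _ (+) _); apply: val_inj.
  rewrite -(IHm (ltnW lt_mk)) (aS (Ordinal (ltnW lt_mk))).
  rewrite [ordS _](_ : _ = Ordinal lt_mk); last by apply: val_inj;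
    rewrite /= modn_small.
  have ->: (Ordinal lt_mk == j) = (j == m.+1 :> nat) by rewrite eq_sym.
  have ->: (Ordinal lt_mk == j') = (j' == m.+1 :> nat) by rewrite eq_sym.
  rewrite /= (leq_eqVlt j m.+1) (leq_eqVlt j' m.+1) !ltnS.
  have := jj'; rewrite -val_eqE /=.
  by case: (a _) (eqVneq (j : nat) m.+1) (eqVneq (j' : nat) m.+1) =>
    [] [->|?] [->|?];
    rewrite ?eqxx ?ltnn //=; case: (j <= m) (j' <= m) => [] [].
rewrite !inE negb_or => /andP[/andP[ij ij'] Di] ii'.
have ni : ~~ connect h (x j) (x i).
  apply/negP => /component_end; rewrite DST => /(_ (imset_f _ Di)).
  by case=> /x_inj e; [move: ij | move: ij']; rewrite e eqxx.
suff e : a i = a i' by have := a0 i i'; rewrite e => /addbI.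
have off u w : connect h (x i) u -> path_cycle (Some u, w) = false.
  move=> iu; have ju : ~~ connect h (x j) u.
    by apply: contra ni => /connect_trans; apply; rewrite h_sym.
  case: w => [w|] /=; first by rewrite (negPf ju).
  by apply: contraNF ju => /orP[]/eqP->; rewrite ?connect0.
(* All darts out of [u] are reached by the rotation, and none of the edges crossed is on the
   cycle. *)
have at_vertex u w w' : connect h (x i) u -> r (Some u) w -> r (Some u) w' ->
    phi (Some u, w) = phi (Some u, w').
  move=> iu rw rw'; have [rot_s _] := plane_s.
  have := rot_s (Some u, w); rewrite inE => /(_ rw (Some u, w')).
  rewrite inE rw' eqxx => /iter_findex <-; elim: findex => //= n ->.
  have := phiP (iter n s (Some u, w)).
  have := rot_s (Some u, w); rewrite inE => /(_ rw (iter n s (Some u, w))).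
  rewrite fconnect_iter => /esym/andP[]; case: (iter n s _) => u' w'' /=;
    rewrite inE /=.
  move=> + /eqP e; rewrite e => rw'' /(_ rw'') [-> _].
  by move: (off u w'' iu) => /= ->; rewrite addbF.
have along u w : connect h (x i) u -> r (Some u) w ->
   phi (Some (x i), None) = phi (Some u, w).
  case/connectP => p; elim/last_ind: p u w => [|p v IHp] u w /=.
    by move=> _ -> rw; apply: at_vertex rw => //; rewrite /= codom_f.
  rewrite rcons_path last_rcons => /andP[hp hv] -> rw.
  have iv : connect h (x i) (last (x i) p) by apply/connectP; exists p.
  have rv : r (Some (last (x i) p)) (Some v).
    by move: hv; rewrite /superposition /= inE => /orP[]; apply: subsetP.
  rewrite (IHp _ (Some v) hp erefl rv).
  have [_] := phiP (Some (last (x i) p), Some v) rv; rewrite off // addbF => <-.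
  apply: (at_vertex v (Some (last (x i) p))) => //;
    last by rewrite dangling_sym.
  by apply: connect_trans iv _; apply: connect1.
have to_None i0 : connect h (x i) (x i0) -> a i0 = phi (Some (x i0), None).
  move=> c0; have [_] := phiP (Some (x i0), None) (codom_f _ _).
  by rewrite (off _ None) // addbF.
rewrite (to_None i) ?connect0 // (to_None i') //.
by apply: along; rewrite //= codom_f.
Qed.

(** [side] selects the indices from the smaller of [j] and [j'] up to just before the larger. By
    [same_side], the paths pair off those of [D] other than [j] and [j']; the smaller end is left
    over, so the number is odd. *)
Lemma opposite_sign :
  odd #|[set i in D | i < j]| (+) odd #|[set i in D | i < j']|.
Proof.
pose side (i : 'I_k) := (i < j) (+) (i < j').
pose B := [set i in D :\: [set j; j'] | side i].
have sideE (i : 'I_k) : side i = (j <= i) (+) (j' <= i).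
  by rewrite /side !ltnNge; case: (j <= i) (j' <= i) => [] [].
have hx i : i \in D -> x i \in half_covered S T by rewrite DST; apply: imset_f.
pose mate i := odflt i [pick i' in D | (i' != i) && connect h (x i) (x i')].
have mateP i : i \in D -> [/\ mate i \in D,
  mate i != i & connect h (x i) (x (mate i))].
  move=> Di; rewrite /mate; case: pickP => [i' /and3P[? ? ?]|none];
    first by split.
  have [y [hy yi iy _]] := half_covered_end PS QT P2 Q2 (hx i Di).
  move: hy yi iy; rewrite DST => /imsetP[i' Di' ->] yi iy.
  by have := none i'; rewrite /= Di' iy andbT -(inj_eq x_inj) yi.
have mate_uniq i i' : i \in D -> i' \in D -> i' != i ->
  connect h (x i) (x i') -> i' = mate i.
  move=> Di Di' nii' cii'; have [Dm mi cm] := mateP i Di.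
  have [y [_ _ _ only]] := half_covered_end PS QT P2 Q2 (hx i Di).
  have [/x_inj e|e] := only _ (hx _ Di') cii'; first by rewrite e eqxx in nii'.
  have [/x_inj e'|e'] := only _ (hx _ Dm) cm; first by rewrite e' eqxx in mi.
  by apply: x_inj; rewrite e e'.
have mateK i : i \in D -> mate (mate i) = i.
  move=> Di; have [Dm mi cm] := mateP i Di.
  by apply/esym/mate_uniq; rewrite // 1?eq_sym // h_sym.
have mate_j : mate j = j' by apply/esym/mate_uniq.
have Beven : ~~ odd #|B|.
  have [|B' [-> _ _]] := @fixfree_involution_half _ B mate;
    last by rewrite odd_double.
  move=> i /setIdP[Di si]; move: (Di);
    rewrite !inE negb_or => /andP[/andP[ij ij'] Di'].
  have [Dm mi cm] := mateP i Di'; split=> //; last exact: mateK.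
  rewrite sideE -(same_side Di cm) -sideE si Dm !andbT negb_or.
  by apply/andP; split; [apply: contraNneq ij' | apply: contraNneq ij] => e;
    rewrite -(mateK i Di') e -?mate_j ?mateK.
pose m := if j < j' then j else j'.
have jj'n : (j' : nat) != j := jj'.
have Dside : [set i in D | side i] = m |: B.
  apply/setP => i; rewrite /B !inE /m /side.
  have [jltj'|j'ltj|e] := ltngtP j j'; last by rewrite e eqxx in jj'n.
    have [->|ij] := eqVneq i j; first by rewrite Dj ltnn jltj'.
    by have [->|//] := eqVneq i j'; rewrite ltnn ltnNge (ltnW jltj') andbF.
  have [->|ij'] := eqVneq i j'; first by rewrite Dj' ltnn j'ltj.
  by have [->|//] := eqVneq i j; rewrite ltnn ltnNge (ltnW j'ltj) andbF.
have cside : #|[set i in D | side i]| = #|B|.+1.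
  by rewrite Dside cardsU1 !inE /m; case: ifP; rewrite eqxx ?orbT.
by rewrite -odd_card_addb cside /= Beven.
Qed.
End NonCrossing.

Local Open Scope ring_scope.

(** * Matchgate identities *)

(** Reindexing by [f] shows that the sum is its own opposite, and 2 can be cancelled in a
    [numDomainType]. *)
Lemma sum_sign_reversing (R : numDomainType) (I : finType) (p : pred I)
    (F : I -> R) (f : I -> I) :
  (forall i, p i -> [/\ p (f i), f (f i) = i & F (f i) = - F i]) ->
  \sum_(i | p i) F i = 0.
Proof.
move=> fP; have e : \sum_(i | p i) F i = - \sum_(i | p i) F i.
  rewrite [LHS](reindex_onto f f) => [|i /fP[]//]; rewrite -sumrN.
  rewrite (eq_bigl p) => [|i]; first by apply: eq_bigr => i /fP[].
  apply/andP/idP => [[/fP[pf _ _] /eqP e]|/fP[pf -> _]]; last by rewrite eqxx.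
  by rewrite -e.
by apply/eqP; rewrite -[_ == 0](mulrn_eq0 _ 2) mulr2n {1}e addNr.
Qed.

(** * Exchanging two matchings on a set of vertices *)

Section Swap.

Variables (V : finType) (K : {set V}).

Definition swap_on (P Q : {set {set V}}) : {set {set V}} :=
  [set A : {set V} | A \in if [disjoint A & K] then P else Q].

Lemma swap_onK P Q : swap_on (swap_on P Q) (swap_on Q P) = P.
Proof. by apply/setP => A; rewrite !inE; case: ifP => dA; rewrite inE dA. Qed.

Lemma swap_onU P Q : swap_on P Q :|: swap_on Q P = P :|: Q.
Proof. by apply/setP => A; rewrite !inE; case: ifP => // _; rewrite orbC. Qed.

Lemma prod_swap_on (R : comNzRingType) (w : {set V} -> R) P Q :
  (\prod_(A in swap_on P Q) w A) * (\prod_(A in swap_on Q P) w A) =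
  (\prod_(A in P) w A) * (\prod_(A in Q) w A).
Proof.
have split X Y : \prod_(A in swap_on X Y) w A =
    (\prod_(A in X | [disjoint A & K]) w A) *
      (\prod_(A in Y | ~~ [disjoint A & K]) w A).
  rewrite (bigID (fun A : {set V} => [disjoint A & K])) /=; congr (_ * _).
    by apply: eq_bigl => A; rewrite inE; case: ifP; rewrite ?andbF.
  by apply: eq_bigl => A; rewrite inE; case: ifP; rewrite ?andbF.
pose d (A : {set V}) := [disjoint A & K].
rewrite !split (bigID d (fun A => A \in P)) (bigID d (fun A => A \in Q)) /=.
by rewrite [X in _ * X]mulrC mulrACA [X in _ * X]mulrC.
Qed.

(** No edge leaves [K], so the edges kept from [P] cover [S] outside [K], those taken from [Q] cover
    [T] inside [K], and the two kinds are disjoint. *)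
Lemma partition_swap_on P Q S T :
  partition P S -> partition Q T ->
  (forall A, A \in P :|: Q -> ~~ [disjoint A & K] -> A \subset K) ->
  partition (swap_on P Q) ((S :\: K) :|: (T :&: K)).
Proof.
move=> /and3P[/eqP covP tP P0] /and3P[/eqP covQ tQ Q0] closedK.
have PQK A : A \in swap_on P Q -> ~~ [disjoint A & K] -> A \subset K.
  by move=> sA dA; apply: (closedK _ _ dA); move: sA;
    rewrite !inE (negPf dA) => ->; rewrite orbT.
have notK (A : {set V}) u : [disjoint A & K] -> u \in A -> u \notin K.
  by move=> /disjointFr d /d->.
apply/and3P; split; last by rewrite inE; case: ifP.
- apply/eqP/setP => u; rewrite !inE; have [uK|uK] := boolP (u \in K);
  rewrite /= ?andbT ?andbF ?orbF.
    apply/bigcupP/idP => [[A]|].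
      rewrite inE; case: ifP => [dA _ uA|_ AQ uA];
        first by rewrite (negPf (notK A u dA uA)) in uK.
      by rewrite -covQ; apply/bigcupP; exists A.
    rewrite -covQ => /bigcupP[A AQ uA]; exists A => //; rewrite inE.
    by case: ifP => // dA; rewrite (negPf (notK A u dA uA)) in uK.
  apply/bigcupP/idP => [[A sA uA]|].
    have dA : [disjoint A & K].
      by apply: contraR uK => /(PQK _ sA)/subsetP; apply.
    by move: sA; rewrite inE dA => AP; rewrite -covP; apply/bigcupP; exists A.
  rewrite -covP => /bigcupP[A AP uA]; exists A => //; rewrite inE ifT //.
  apply: contraR uK => dA; suff /subsetP : A \subset K by apply.
  by apply: closedK => //; rewrite inE AP.
apply/trivIsetP => A B sA sB nAB.
have mixed X Y : X \in swap_on P Q -> ~~ [disjoint X & K] ->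
  [disjoint Y & K] -> [disjoint X & Y].
  by move=> sX /(PQK _ sX) XK dY; apply: disjointWl XK _; rewrite disjoint_sym.
have [dA|dA] := boolP [disjoint A & K]; have [dB|dB] := boolP [disjoint B & K].
- by move: sA sB; rewrite !inE dA dB => sA sB; exact: (trivIsetP tP).
- by rewrite disjoint_sym; apply: mixed.
- exact: mixed.
- by move: sA sB; rewrite !inE (negPf dA) (negPf dB) => sA sB;
  exact: (trivIsetP tQ).
Qed.

End Swap.

Section Flip.
Variable I : finType.
Implicit Types b c : {ffun I -> bool}.
Definition flip b i : {ffun I -> bool} := [ffun j => b j (+) (j == i)].
Definition diff_set b c : {set I} := [set i | b i (+) c i].

Lemma diff_set_flip b c i : diff_set (flip b i) (flip c i) = diff_set b c.
Proof. by apply/setP => j; rewrite !inE !ffunE addbACA addbb addbF. Qed.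

End Flip.

(** The sum in the matchgate identity, as an operator on functions of two strings: it is applied
    both to a whole signature and to a single block. *)
Definition flip_sum (R : comNzRingType) (k : nat)
    (u : {ffun 'I_k -> bool} -> {ffun 'I_k -> bool} -> R) (b c : {ffun 'I_k ->
      bool}) : R :=
  \sum_(j in diff_set b c) (-1) ^+ #|[set i in diff_set b c | (i < j)%N]| *
     u (flip b j) (flip c j).


Section MatchgateIdentity.

Variables (R : numDomainType) (k : nat) (G : matchgate R k).

Local Notation V := (mg_vertex G).
Local Notation E := (mg_edges G).
Local Notation x := (@mg_external _ _ G).
Implicit Types b c : {ffun 'I_k -> bool}.

Definition covered b : {set V} := ~: [set x i | i : 'I_k & b i].

Lemma covered_external b i : (x i \in covered b) = ~~ b i.
Proof. by rewrite inE mem_imset ?inE //; apply: mg_external_inj. Qed.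

Lemma covered_internal b u : u \notin codom x -> u \in covered b.
Proof.
by move=> nu; rewrite inE; apply: contra nu => /imsetP[i _ ->]; apply: codom_f.
Qed.

Lemma half_covered_diff b c :
  half_covered (covered b) (covered c) = x @: diff_set b c.
Proof.
apply/setP => u; rewrite half_coveredE;
  have [/codomP[i ->]|nu] := boolP (u \in codom x).
  rewrite !covered_external mem_imset ?inE ?addbN ?addNb ?negbK //.
  exact: mg_external_inj.
rewrite !covered_internal //; apply/esym/negbTE; apply: contra nu.
by move=> /imsetP[i _ ->]; apply: codom_f.
Qed.

Local Notation triple := ('I_k * ({set {set V}} * {set {set V}}))%type.

(** The triples index the terms of the expanded identity: a flipped position and one matching for
    each factor. *)
Definition superposed b c (t : triple) :=
  [&& t.1 \in diff_set b c,
      (t.2.1 \subset E) && partition t.2.1 (covered (flip b t.1)) &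
      (t.2.2 \subset E) && partition t.2.2 (covered (flip c t.1))].

Definition component (t : triple) : {set V} :=
  [set u | connect (superposition t.2.1 t.2.2) (x t.1) u].

(** By [other_endP], the default is never taken on a superposed triple. *)
Definition other_end b c (t : triple) : 'I_k :=
  odflt t.1 [pick i in diff_set b c | (i != t.1) && (x i \in component t)].

(** The sign-reversing involution: the matchings are exchanged along the path from [x t.1], and the
    flip moves to its other end. *)
Definition switch b c (t : triple) : triple :=
  (other_end b c t, (swap_on (component t) t.2.1 t.2.2,
    swap_on (component t) t.2.2 t.2.1)).

Section Switch.

Variables (b c : {ffun 'I_k -> bool}) (t : triple).
Hypothesis bct : superposed b c t.

Let j := t.1.
Let P := t.2.1.
Let Q := t.2.2.
Let K := component t.
Let Dj : j \in diff_set b c. Proof. by case/and3P: bct. Qed.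
Let PE : P \subset E. Proof. by case/and3P: bct => _ /andP[]. Qed.
Let QE : Q \subset E. Proof. by case/and3P: bct => _ _ /andP[]. Qed.
Let PS : partition P (covered (flip b j)). Proof.
by case/and3P: bct => _ /andP[]. Qed.
Let QT : partition Q (covered (flip c j)). Proof.
by case/and3P: bct => _ _ /andP[]. Qed.
Let P2 A : A \in P -> #|A| = 2. Proof. by move=> /(subsetP PE)/mg_edges_card2.
Qed.
Let Q2 A : A \in Q -> #|A| = 2. Proof. by move=> /(subsetP QE)/mg_edges_card2.
Qed.

Lemma other_endP :
  let j' := other_end b c t in
  [/\ j' \in diff_set b c, j' != j, x j' \in K &
    forall i, i \in diff_set b c -> (x i \in K) = (i == j) || (i == j')].
Proof.
have hx i : i \in diff_set b c ->
  x i \in half_covered (covered (flip b j)) (covered (flip c j)).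
  by move=> Di; rewrite half_covered_diff diff_set_flip; apply: imset_f.
have inj := @mg_external_inj _ _ G.
have [y [hy yx xy only]] := half_covered_end PS QT P2 Q2 (hx _ Dj).
move: hy; rewrite half_covered_diff diff_set_flip => /imsetP[i Di defy].
have Ki : x i \in K by rewrite inE -defy.
have Kj : x j \in K by rewrite inE connect0.
have ij : i != j by rewrite -(inj_eq inj) -defy.
have uniqK i' : i' \in diff_set b c -> x i' \in K -> i' = j \/ i' = i.
  move=> Di'; rewrite inE => /(only _ (hx _ Di')).
  by case=> [/inj|]; [left | rewrite defy => /inj; right].
have -> : other_end b c t = i.
  rewrite /other_end; case: pickP => [i' /and3P[Di' ij' Ki'] /=|/(_ i)];
    last first.
    by rewrite Di ij Ki.
  by have [e|] := uniqK _ Di' Ki' => //; rewrite e eqxx in ij'.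
split=> // i' Di'; apply/idP/idP => [/(uniqK _ Di')[]->|];
  rewrite ?eqxx ?orbT //.
by case/orP=> /eqP->.
Qed.

Lemma component_closed A : A \in P :|: Q -> ~~ [disjoint A & K] -> A \subset K.
Proof.
move=> APQ /pred0Pn[u /andP[/= uA uK]].
have /cards2P[v [w [_ defA]]] : #|A| == 2.
  by case/setUP: APQ => [/P2|/Q2] ->.
have hvw : superposition P Q v w by rewrite /superposition /= -defA.
have hwv : superposition P Q w v by rewrite superposition_sym.
rewrite defA; apply/subsetP => z; move: uA uK; rewrite defA !inE => + uK.
by case/orP=> /eqP e /orP[]/eqP->; rewrite -?e //;
   apply: (connect_trans uK); rewrite e connect1.
Qed.

End Switch.

Lemma component_switch b c t : superposed b c t ->
  component (switch b c t) = component t.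
Proof.
move=> bct; have [_ _ + _] := other_endP bct.
rewrite [in X in X -> _]inE => jj'; apply/setP => u; rewrite !inE.
have hE : superposition (swap_on (component t) t.2.1 t.2.2)
    (swap_on (component t) t.2.2 t.2.1) =2 superposition t.2.1 t.2.2.
  by move=> v w; rewrite /superposition /= swap_onU.
rewrite (eq_connect hE); apply/esym/same_connect => //.
exact/sym_connect_sym/superposition_sym.
Qed.

(** The sets covered for [b] and [c] differ only at external nodes of [diff_set b c], and the
    component contains just two of these, its ends. Exchanging there undoes the flip at [t.1] and
    makes one at [j']. *)
Lemma covered_switch b c t (j' := other_end b c t) : superposed b c t ->
  (covered (flip b t.1) :\: component t) :|:
    (covered (flip c t.1) :&: component t) =
  covered (flip b j').
Proof.
move=> bct; have [Dj' nj' _ KE] := other_endP bct.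
have Dj : t.1 \in diff_set b c by case/and3P: bct.
rewrite -/j' in Dj' nj' KE.
apply/setP => u; rewrite in_setU in_setD in_setI.
have [/codomP[i ->]|nu] := boolP (u \in codom x); last first.
  by rewrite !covered_internal // andbT /= orNb.
rewrite !covered_external !ffunE; have [Di|nDi] := boolP (i \in diff_set b c).
  rewrite KE //; have := Di; rewrite inE; have [->|ij] := eqVneq i t.1.
    by rewrite eq_sym (negPf nj'); case: (b _) (c _) => [] [].
  by have [->|_] := eqVneq i j'; case: (b _) (c _) => [] [].
have -> : (i == t.1) = false by apply: contraNF nDi => /eqP->.
have -> : (i == j') = false by apply: contraNF nDi => /eqP->.
by move: nDi; rewrite inE; case: (b i) (c i) (_ \in _) => [] [] [].
Qed.

Lemma superposed_sym b c t : superposed b c t =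
  superposed c b (t.1, (t.2.2, t.2.1)).
Proof.
by rewrite /superposed /= [X in _ && X]andbC /diff_set; congr andb;
  rewrite !inE addbC.
Qed.

Lemma component_sym t : component (t.1, (t.2.2, t.2.1)) = component t.
Proof.
apply/setP => u; rewrite !inE; apply: eq_connect => v w.
by rewrite /superposition /= [_ :|: t.2.1]setUC.
Qed.

Lemma other_end_sym b c t : other_end c b (t.1, (t.2.2,
  t.2.1)) = other_end b c t.
Proof.
rewrite /other_end component_sym; congr odflt; apply: eq_pick => i /=.
by rewrite !inE addbC.
Qed.

Lemma switch_superposed b c t : superposed b c t ->
  superposed b c (switch b c t).
Proof.
move=> bct; have [Dj' _ _ _] := other_endP bct.
have /and3P[_ /andP[PE PS] /andP[QE QT]] := bct.
have sE (X Y : {set {set V}}) : X \subset E -> Y \subset E ->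
  swap_on (component t) X Y \subset E.
  by move=> XE YE; apply/subsetP => A; rewrite inE; case: ifP => _;
    apply: subsetP.
apply/and3P; split=> //=; rewrite sE //=.
  rewrite -(covered_switch bct); apply: partition_swap_on => // A.
  exact: (component_closed bct (A := A)).
have bct' := bct; rewrite superposed_sym in bct'.
have := covered_switch bct'; rewrite other_end_sym component_sym /= => <-.
apply: partition_swap_on => // A; rewrite setUC;
  exact: (component_closed bct (A := A)).
Qed.

Lemma switchK b c t : superposed b c t -> switch b c (switch b c t) = t.
Proof.
move=> bct; have bct' := switch_superposed bct.
have [Dj' nj' Kj' KE] := other_endP bct;
  have [D'' n'' K'' _] := other_endP bct'.
have cK := component_switch bct.
rewrite [LHS]/switch cK /= !swap_onK.
have -> : other_end b c (switch b c t) = t.1.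
  rewrite cK in K''; move: K''; rewrite KE // => /orP[/eqP //|e].
  by rewrite e in n''.
by case: (t) => j [P Q].
Qed.

(** [switch] preserves the product of weights by [prod_swap_on] and reverses the sign by
    [opposite_sign], so the terms cancel. *)
Lemma matchgate_identity b c :
  flip_sum (fun b' c' => matchgate_sig G b' * matchgate_sig G c') b c = 0.
Proof.
pose sgn j : R := (-1) ^+ #|[set i in diff_set b c | (i < j)%N]|.
pose wt (P : {set {set V}}) := \prod_(A in P) mg_weight A.
pose F (t : triple) := sgn t.1 * (wt t.2.1 * wt t.2.2).
transitivity (\sum_(t | superposed b c t) F t).
  have e j : matchgate_sig G (flip b j) * matchgate_sig G (flip c j) =
      \sum_(t : {set {set V}} * {set {set V}} |
          ((t.1 \subset E) && partition t.1 (covered (flip b j))) &&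
          ((t.2 \subset E) && partition t.2 (covered (flip c j)))) wt t.1 *
            wt t.2.
    by rewrite /matchgate_sig /perf_match big_distrlr /= pair_big.
  rewrite /flip_sum; under eq_bigr => j _ do rewrite e mulr_sumr.
  by rewrite pair_big_dep.
apply: (sum_sign_reversing (f := switch b c)) => t bct.
split; [exact: switch_superposed | exact: switchK |].
have [Dj' nj' Kj' KE] := other_endP bct.
rewrite /F /= prod_swap_on -mulNr; congr (_ * _).
have /and3P[Dj /andP[PE PS] /andP[QE QT]] := bct.
have [s [plane_s s_x]] := mg_plane G.
have := opposite_sign (@mg_edges_card2 _ _ G) (@mg_external_inj _ _ G) plane_s
  s_x PE QE PS QT.
move=> /(_ (diff_set b c));
  rewrite half_covered_diff diff_set_flip => /(_ erefl _ _ Dj Dj' nj').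
rewrite inE in Kj' => /(_ Kj').
rewrite /sgn -signr_odd -[in RHS]signr_odd; case: odd; case: odd => //= _.
  by rewrite opprK.
Qed.

End MatchgateIdentity.

(** * Tensors satisfying the matchgate identities *)

Section FlipFacts.
Variable I : finType.
Implicit Types b c : {ffun I -> bool}.

Lemma flipK i : involutive (fun b => flip b i).
Proof. by move=> b; apply/ffunP => j; rewrite !ffunE addbK. Qed.

Definition parity b := odd #|[set i | b i]|.

Lemma odd_diff_set b c : odd #|diff_set b c| = parity b (+) parity c.
Proof.
have := odd_card_addb [set: I] b c.
have e (p : pred I) : [set i in [set: I] | p i] = [set i | p i].
  by apply/setP => i; rewrite !inE.
by rewrite !e.
Qed.

Lemma parity_flip b i : parity (flip b i) = ~~ parity b.
Proof.
have := odd_diff_set b (flip b i).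
have -> : diff_set b (flip b i) = [set i].
  by apply/setP => j; rewrite !inE ffunE addKb.
by rewrite cards1 /=; case: parity; case: parity.
Qed.

End FlipFacts.

(** * Rigidity of the solutions of the identities *)

Section Rigidity.
Variables (R : fieldType) (k : nat).
Implicit Types (v w : {ffun 'I_k -> bool} -> R).

(** Subtracting a multiple of [v] makes [w'] vanish at [g]; induction on the distance from [g] then
    shows that [w'] is zero. *)
Lemma flip_sum_rigid v w g :
  (forall b c, flip_sum (fun b' c' => v b' * v c') b c = 0) ->
  (forall b c, flip_sum (fun b' c' => v b' * w c') b c = 0) ->
  v g != 0 -> forall d, w d = w g / v g * v d.
Proof.
move=> vv vw vg; pose w' d := w d - w g / v g * v d.
have vw' b c : flip_sum (fun b' c' => v b' * w' c') b c = 0.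
  transitivity (flip_sum (fun b' c' => v b' * w c') b c -
      w g / v g * flip_sum (fun b' c' => v b' * v c') b c).
    rewrite /flip_sum mulr_sumr -sumrB; apply: eq_bigr => j _.
    by rewrite /w'; ring.
  by rewrite vv vw mulr0 subr0.
suff w0 d : w' d = 0 by move=> d; apply/eqP; rewrite -subr_eq0; apply/eqP/w0.
have [m] := ubnP #|diff_set g d|; elim: m d => // m IHm d.
have [D0 _|/set0Pn[j Dj]] := eqVneq (diff_set g d) set0; last first.
  (* In this instance the term [j] is [v g * w' d] up to sign. In any other term [i], the argument
     of [w'] is [d] flipped at [i] and [j], which is closer to [g]. *)
  rewrite ltnS => dm; have := vw' (flip g j) (flip d j).
  rewrite /flip_sum diff_set_flip (bigD1 j) //= big1 ?addr0 =>
    [|i /andP[Di ij]].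
    rewrite !flipK => /eqP; rewrite !mulf_eq0 signr_eq0 (negPf vg) /=.
    by move/eqP.
  rewrite IHm ?mulr0 //; apply: leq_trans dm.
  apply: proper_card; apply/properP; split.
    apply/subsetP => t; rewrite !inE !ffunE; have [->|] := eqVneq t i;
      last first.
      by have [->|] := eqVneq t j; rewrite ?addbF // inE in Dj *.
    by move=> _; rewrite inE in Di.
  by exists j => //; move: Dj; rewrite !inE !ffunE eqxx eq_sym (negPf ij);
    case: (g j) (d j) => [] [].
suff -> : d = g by rewrite /w' divfK // subrr.
apply/ffunP => i; have : i \notin diff_set g d by rewrite D0 inE.
by rewrite inE; case: (d i) (g i) => [] [].
Qed.
End Rigidity.

(** * Contraction with product functionals *)

Section Contraction.

Variables (R : comNzRingType) (k : nat).
Local Notation B := {ffun 'I_k -> bool}.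
Implicit Types (f u : B -> B -> R).

Definition pairing f u : R := \sum_(w : B * B) f w.1 w.2 * u w.1 w.2.

Definition signed u : B -> B -> R := fun b c => (-1) ^+ #|diff_set b c| * u b c.

(* The factor of block [j] when [flip_sum] acts on block [i]; the sign of a flip
   counts all differences in the preceding blocks. *)
Definition leibniz_factor (i j : nat) u : B -> B -> R :=
  if (j < i)%N then signed u else if j == i then flip_sum u else u.

(** The operator of the identity acts on a tensor power of [u] as a signed derivation; the result is
    contracted with [f j] in block [j]. *)
Definition leibniz_sum (n : nat) (f : nat -> B -> B -> R) u : R :=
  \sum_(i < n) \prod_(j < n) pairing (f j) (leibniz_factor i j u).

Lemma leibniz_sum_recl n (f : nat -> B -> B -> R) u :
  leibniz_sum n.+1 f u =
    pairing (f 0) (flip_sum u) * \prod_(j < n) pairing (f j.+1) u +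
    pairing (f 0) (signed u) * leibniz_sum n (fun j => f j.+1) u.
Proof.
rewrite /leibniz_sum big_ord_recl big_ord_recl mulr_sumr; congr (_ + _).
by apply: eq_bigr => i _; rewrite big_ord_recl.
Qed.

End Contraction.

(** * The identity for a sum of tensor powers, block by block *)

Section BlockIdentity.

Variables (R : comNzRingType) (n l : nat) (A : finType).
Local Notation B := {ffun 'I_l -> bool}.
Variable v : A -> B -> R.

Definition block (b : {ffun 'I_(n * l) -> bool}) (i : 'I_n) : B :=
  [ffun j => b (mxtens_index (i, j))].

Definition unblock (z : 'I_n -> B) : {ffun 'I_(n * l) -> bool} :=
  [ffun p => z (mxtens_unindex p).1 (mxtens_unindex p).2].

Definition outer (D : A * A) : B -> B -> R := fun b c => v D.1 b * v D.2 c.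

Lemma unblock_index z i j : unblock z (mxtens_index (i, j)) = z i j.
Proof. by rewrite ffunE mxtens_indexK. Qed.

Lemma block_flip z i j i' :
  block (flip (unblock z) (mxtens_index (i,
    j))) i' = if i' == i then flip (z i) j else z i'.
Proof.
apply/ffunP => t; rewrite !ffunE mxtens_indexK /= (can_eq (@mxtens_indexK n l))
  xpair_eqE.
by case: eqP => [->|_]; rewrite ?ffunE ?addbF.
Qed.

Lemma mxtens_index_lt (i i' : 'I_n) (j j' : 'I_l) :
  (mxtens_index (i, j) < mxtens_index (i',
    j'))%N = (i < i')%N || (i == i') && (j < j')%N.
Proof.
rewrite /= -val_eqE /=; have := ltn_ord j; have := ltn_ord j'.
case: ltngtP => [lt|gt|->]; nia.
Qed.

(** [mxtens_index] is increasing for the lexicographic order: what precedes a position is all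
    earlier blocks and the start of its own. *)
Lemma card_diff_before z z' i (j : 'I_l) :
  #|[set p in diff_set (unblock z) (unblock z') | (p < mxtens_index (i,
    j))%N]| =
  (\sum_(i' < n | (i' < i)%N) #|diff_set (z i') (z' i')| +
   #|[set t in diff_set (z i) (z' i) | (t < j)%N]|)%N.
Proof.
rewrite -sum1dep_card big_mkcond (reindex (@mxtens_index n l)) /=; last first.
  by exists (@mxtens_unindex n l) => p _;
    rewrite ?mxtens_indexK ?mxtens_unindexK.
pose G (i' : 'I_n) (t : 'I_l) : nat :=
  if (t \in diff_set (z i') (z' i')) && ((i' < i)%N || (i' == i) &&
    (t < j)%N) then 1 else 0.
transitivity (\sum_i' \sum_t G i' t)%N.
  rewrite pair_bigA; apply: eq_bigr => -[i' t] _ /=.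
  by rewrite /G -mxtens_index_lt !inE !ffunE !mxtens_indexK.
rewrite (bigID (fun i' : 'I_n => (i' < i)%N)) /=; congr addn.
  apply: eq_bigr => i' lti; rewrite -sum1_card [RHS]big_mkcond;
    apply: eq_bigr => t _.
  by rewrite /G lti andbT.
rewrite (bigD1 i) ?ltnn //= -sum1dep_card [X in _ =
  X]big_mkcond /= -[RHS]addn0; congr addn.
  by apply: eq_bigr => t _; rewrite /G ltnn eqxx.
by rewrite big1 // => i' /andP[/negPf ni /negPf ni']; rewrite big1 // => t _;
  rewrite /G ni ni' andbF.
Qed.

Hypothesis tensor_identity : forall b c : {ffun 'I_(n * l) -> bool},
  flip_sum (fun b' c' => (\sum_a \prod_i v a (block b' i)) *
                         (\sum_a \prod_i v a (block c' i))) b c = 0.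

Lemma tensor_square (s t : 'I_n -> B) :
  (\sum_a \prod_i v a (s i)) * (\sum_a \prod_i v a (t i)) =
  \sum_D \prod_i outer D (s i) (t i).
Proof.
rewrite big_distrlr pair_bigA /=; apply: eq_bigr => D _.
by rewrite -big_split.
Qed.

Lemma mem_diff_unblock z z' i j :
  (mxtens_index (i, j) \in diff_set (unblock z) (unblock z')) =
    (j \in diff_set (z i) (z' i)).
Proof. by rewrite !inE !unblock_index. Qed.

(** By [card_diff_before], the sign of a flip in block [i] is the product of the signs of the
    earlier blocks, absorbed by [signed], and of the sign within the block, absorbed by
    [flip_sum]. *)
Lemma leibniz_factor_prod (D : A * A) z z' (i : 'I_n) :
  \prod_(j < n) leibniz_factor i j (outer D) (z j) (z' j) =
  \sum_(j in diff_set (z i) (z' i))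
    (-1) ^+ #|[set p in diff_set (unblock z) (unblock z') | (p < mxtens_index
      (i, j))%N]| *
    \prod_(i' < n) outer D (if i' == i then flip (z i) j else z i')
                           (if i' == i then flip (z' i) j else z' i').
Proof.
rewrite (bigD1 i) //= {1}/leibniz_factor ltnn eqxx /flip_sum mulr_suml.
apply: eq_bigr => j _;
  rewrite [in RHS](bigD1 i) //= eqxx card_diff_before exprD expr_sum.
have -> : \prod_(i' < n | i' != i) leibniz_factor i i' (outer D) (z i') (z' i')
  =
    (\prod_(i' < n | (i' < i)%N) (-1) ^+ #|diff_set (z i') (z' i')|) *
    \prod_(i' < n | i' != i) outer D (if i' == i then flip (z i) j else z i')
                           (if i' == i then flip (z' i) j else z' i').
  rewrite [X in _ = X * _](eq_bigl (fun i' : 'I_n =>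
    (i' != i) && (i' < i)%N)) => [|i']; last first.
    by rewrite -val_eqE neq_ltn /=; case: (i' < i)%N; rewrite ?andbF.
  rewrite big_mkcondr -big_split; apply: eq_bigr => i' /negPf ni.
  rewrite ni /leibniz_factor [_ == _ :> nat]ni.
  by case: (i' < i)%N => /=; rewrite ?mul1r.
by ring.
Qed.

Lemma block_identity (z z' : 'I_n -> B) :
  \sum_D \sum_(i < n) \prod_(j < n) leibniz_factor i j (outer D) (z j) (z' j) =
    0.
Proof.
rewrite -[RHS](tensor_identity (unblock z) (unblock z')).
rewrite exchange_big /flip_sum [RHS]big_mkcond /=.
rewrite [RHS](reindex (@mxtens_index n l)) /=; last first.
  by exists (@mxtens_unindex n l) => p _;
    rewrite ?mxtens_indexK ?mxtens_unindexK.
pose G (i : 'I_n) (j : 'I_l) := if j \in diff_set (z i) (z' i) then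
   (-1) ^+ #|[set p in diff_set (unblock z) (unblock z') | (p < mxtens_index
     (i, j))%N]| *
    \sum_D \prod_(i' < n) outer D (if i' == i then flip (z i) j else z i')
                           (if i' == i then flip (z' i) j else z' i') else 0.
transitivity (\sum_i \sum_j G i j); last first.
  rewrite pair_bigA; apply: eq_bigr => -[i j] _ /=.
  rewrite mem_diff_unblock /G; case: ifP => // _; congr (_ * _).
  rewrite tensor_square; apply: eq_bigr => D _; apply: eq_bigr => i' _.
  by rewrite !block_flip.
apply: eq_bigr => i _; rewrite -big_mkcond.
under eq_bigr do rewrite leibniz_factor_prod.
by rewrite exchange_big; apply: eq_bigr => j _; rewrite mulr_sumr.
Qed.

Lemma leibniz_identity (f : nat -> B -> B -> R) :
  \sum_D leibniz_sum n f (outer D) = 0.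
Proof.
transitivity (\sum_(z : {ffun 'I_n ->
  B * B}) (\prod_(j < n) f j (z j).1 (z j).2) *
   \sum_D \sum_(i < n) \prod_(j < n) leibniz_factor i j (outer D) (z j).1 (z
     j).2).
  under [RHS]eq_bigr do rewrite mulr_sumr.
  rewrite [RHS]exchange_big /=; apply: eq_bigr => D _.
  under [RHS]eq_bigr do rewrite mulr_sumr.
  rewrite [RHS]exchange_big /=; apply: eq_bigr => i _.
  rewrite /pairing bigA_distr_bigA /=; apply: eq_bigr => z _.
  by rewrite big_split.
by rewrite big1 // => z _;
  rewrite (block_identity (fun j => (z j).1) (fun j => (z j).2)) mulr0.
Qed.

End BlockIdentity.

(** * Functionals supported on pairs of even distance *)

Section EvenFunctionals.

Variables (R : comNzRingType) (k : nat).
Local Notation B := {ffun 'I_k -> bool}.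
Implicit Types (f u : B -> B -> R) (w : B * B).

Definition vanishes_on_odd u := forall b c, odd #|diff_set b c| -> u b c = 0.

Definition point_functional w : B -> B -> R := fun b c => ((b, c) == w)%:R.

Definition even_part f : B -> B -> R := fun b c =>
  if odd #|diff_set b c| then 0 else f b c.

Lemma even_partP f : vanishes_on_odd (even_part f).
Proof. by move=> b c; rewrite /even_part => ->. Qed.

Lemma point_functional_even w : ~~ odd #|diff_set w.1 w.2| ->
  vanishes_on_odd (point_functional w).
Proof.
move=> ew b c obc; rewrite /point_functional; case: eqP => // e.
by rewrite -e obc in ew.
Qed.

Lemma pairing_point w u : pairing (point_functional w) u = u w.1 w.2.
Proof.
rewrite /pairing (bigD1 w) //= /point_functional big1 => [|t /negPf tw].
  by rewrite -surjective_pairing eqxx mul1r addr0.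
by rewrite -surjective_pairing tw mul0r.
Qed.

Lemma pairing_signed f u : vanishes_on_odd f ->
  pairing f (signed u) = pairing f u.
Proof.
move=> ef; apply: eq_bigr => w _; rewrite /signed -signr_odd.
by have [/ef->|] := boolP (odd _); rewrite ?mul0r // mul1r.
Qed.

Lemma pairing_even_part f u : vanishes_on_odd u ->
  pairing (even_part f) u = pairing f u.
Proof.
move=> eu; apply: eq_bigr => w _; rewrite /even_part.
by case: ifP => // /eu ->; rewrite !mulr0.
Qed.

Lemma pairing0 f u : vanishes_on_odd f ->
  (forall b c, ~~ odd #|diff_set b c| -> u b c = 0) -> pairing f u = 0.
Proof.
move=> ef u0; apply: big1 => w _.
by have [/ef->|/u0->] := boolP (odd #|diff_set w.1 w.2|); rewrite ?mul0r ?mulr0.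
Qed.

(** An even functional does not see the signs, so all positions of the flip contribute equally. *)
Lemma leibniz_sum_const n f u : vanishes_on_odd f ->
  leibniz_sum n.+1 (fun=> f) u =
    n.+1%:R * pairing f (flip_sum u) * pairing f u ^+ n.
Proof.
move=> ef; elim: n => [|n IHn]; rewrite leibniz_sum_recl.
  by rewrite big_ord0 /leibniz_sum big_ord0 mulr0 addr0 mul1r.
rewrite IHn prodr_const card_ord pairing_signed // exprS; ring.
Qed.

Lemma leibniz_sum0 n (f : nat -> B -> B -> R) u :
  (forall i, pairing (f i) (flip_sum u) = 0) -> leibniz_sum n f u = 0.
Proof.
move=> f0; apply: big1 => i _; rewrite (bigD1 i) //=.
by rewrite {1}/leibniz_factor ltnn eqxx f0 mul0r.
Qed.

End EvenFunctionals.

(** * Vectors of an Equality of arity at least 3 *)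

Section EqualityRigidity.

Variables (R : numFieldType) (n k : nat) (A : finType).
Local Notation B := {ffun 'I_k -> bool}.
Variables (v dual : A -> B -> R).
Hypothesis dualP : forall a a', \sum_b dual a b * v a' b = (a == a')%:R.
Hypothesis leibniz : forall f, \sum_D leibniz_sum n.+3 f (outer v D) = 0.

Lemma pairing_dual (D D' : A * A) : pairing (outer dual D) (outer v D') =
  (D == D')%:R.
Proof.
case: D D' => [a1 a2] [a1' a2'];
  rewrite xpair_eqE -mulnb natrM -!dualP big_distrlr /=.
by rewrite /pairing pair_bigA /=; apply: eq_bigr => w _;
  rewrite /outer /= mulrACA.
Qed.

Lemma prod_pairing_dual m (D D' : A * A) :
  \prod_(i < m.+1) pairing (outer dual D) (outer v D') = (D == D')%:R.
Proof.
rewrite prodr_const card_ord pairing_dual.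
by case: eqP => _; rewrite ?expr1n ?expr0n.
Qed.

(* The terms where [flip_sum] acts beyond the first two blocks are symmetric in
   [f1] and [f2], so they cancel when the two are exchanged. *)
Lemma swap_identity f1 f2 D :
  pairing f1 (flip_sum (outer v D)) *
    (pairing f2 (outer v D) - pairing f2 (signed (outer v D))) =
  pairing f2 (flip_sum (outer v D)) *
    (pairing f1 (outer v D) - pairing f1 (signed (outer v D))).
Proof.
(* With [n.+3] blocks, at least one is left for the dual of [D]. It removes every other [D'], except
   for terms symmetric in [g1] and [g2]. *)
pose F g1 g2 (i : nat) : B -> B -> R :=
  match i with 0 => g1 | 1 => g2 | _ => outer dual D end.
have FE g1 g2 D' (u := outer v D') : leibniz_sum n.+3 (F g1 g2) u =
    pairing g1 (flip_sum u) * (pairing g2 u * (D == D')%:R) +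
    pairing g1 (signed u) * (pairing g2 (flip_sum u) * (D == D')%:R +
      pairing g2 (signed u) * leibniz_sum n.+1 (fun=> outer dual D) u).
  by rewrite leibniz_sum_recl big_ord_recl leibniz_sum_recl /=
    !prod_pairing_dual.
have := leibniz (F f1 f2); rewrite -[RHS](leibniz (F f2 f1)) => /eqP.
rewrite -subr_eq0 -sumrB (bigD1 D) //= big1 ?addr0 => [|D' DD'].
  rewrite !FE eqxx /= !mulr1 => /eqP e.
  by apply/eqP; rewrite -subr_eq0 -[X in _ == X]e; apply/eqP; ring.
by rewrite !FE eq_sym (negPf DD') /= !mulr0; ring.
Qed.

(** In [swap_identity] at the two points, the right side vanishes, since the sign is 1 at [w]; the
    left side is twice the product of the wanted value and the nonzero value at [w0]. *)
Lemma flip_sum_mixed (D : A * A) w0 w :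
  odd #|diff_set w0.1 w0.2| -> outer v D w0.1 w0.2 != 0 ->
  ~~ odd #|diff_set w.1 w.2| -> flip_sum (outer v D) w.1 w.2 = 0.
Proof.
move=> ow0 nz ew; have :=
  swap_identity (point_functional R w) (point_functional R w0) D.
rewrite !pairing_point /signed -!(signr_odd _ #|_|) ow0 (negPf ew) /= mul1r
  subrr mulr0.
rewrite mulN1r opprK -mulr2n => /eqP;
  rewrite mulf_eq0 mulrn_eq0 (negPf nz) /= orbF.
by move/eqP.
Qed.

(** Contraction with an even [f0] in the first block and the even part [d] of the dual of [D] in the
    others isolates [D]: other pure [D'] pair to zero with [d], and for mixed [D'] every term
    vanishes by [flip_sum_mixed]. *)
Lemma flip_sum_pure (D : A * A) w : vanishes_on_odd (outer v D) ->
  ~~ odd #|diff_set w.1 w.2| -> flip_sum (outer v D) w.1 w.2 = 0.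
Proof.
move=> pureD ew; pose d := even_part (outer dual D).
have ed : vanishes_on_odd d := @even_partP _ _ _.
have lz f0 : vanishes_on_odd f0 ->
    pairing f0 (flip_sum (outer v D)) +
    pairing f0 (outer v D) * (n.+2%:R * pairing d (flip_sum (outer v D))) = 0.
  move=> ef0; pose F (i : nat) := if i is 0 then f0 else d.
  have := leibniz F; rewrite (bigD1 D) //= big1 ?addr0 => [|D' DD'].
    rewrite leibniz_sum_recl /= pairing_signed // leibniz_sum_const //
      prodr_const card_ord.
    by rewrite {1 4}/d pairing_even_part // pairing_dual eqxx !expr1n !mulr1.
  have [pureD'|] := boolP [forall w : B * B,
    odd #|diff_set w.1 w.2| ==> (outer v D' w.1 w.2 == 0)].
    have {}pureD' : vanishes_on_odd (outer v D').
      by move=> b c obc; have /forallP/(_ (b, c))/implyP/(_ obc)/eqP := pureD'.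
    (* Both terms contain a positive power of the zero [pairing d (outer v D')]; in the second, the
       exponent is [n.+1] thanks to the third block. *)
    rewrite leibniz_sum_recl /= leibniz_sum_const // prodr_const card_ord.
    rewrite /d pairing_even_part // pairing_dual eq_sym (negPf DD') !expr0n /=.
    by rewrite !mulr0 addr0.
  case/forallPn => w0; rewrite negb_imply => /andP[ow0 nz].
  apply: leibniz_sum0 => i; apply: pairing0; first by case: i.
  by move=> b c ebc; apply: (flip_sum_mixed (w := (b, c)) ow0 nz).
(* For [f0 := d] the relation [lz] reads [n.+3] times this pairing equals zero, and the
   characteristic is zero. *)
have d0 : pairing d (flip_sum (outer v D)) = 0.
  have := lz d ed; rewrite {2}/d pairing_even_part // pairing_dual eqxx mul1r.
  by rewrite -[X in X + _]mul1r -mulrDl nat1r => /eqP;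
    rewrite mulf_eq0 pnatr_eq0 => /eqP.
have := lz _ (@point_functional_even R k w ew); rewrite d0 !mulr0 addr0.
by rewrite pairing_point.
Qed.

Lemma flip_sum_even (D : A * A) b c :
  ~~ odd #|diff_set b c| -> flip_sum (outer v D) b c = 0.
Proof.
move=> ebc.
have [pureD|] := boolP [forall w : B * B,
  odd #|diff_set w.1 w.2| ==> (outer v D w.1 w.2 == 0)].
  apply: (flip_sum_pure (w := (b, c))) => // b' c' o.
  by have /forallP/(_ (b', c'))/implyP/(_ o)/eqP := pureD.
case/forallPn => w0; rewrite negb_imply => /andP[ow0 nz].
exact: (flip_sum_mixed (w := (b, c)) ow0 nz).
Qed.

Definition parity_part p a : B -> R := fun b =>
  if parity b == p then v a b else 0.

(** If [b] and [c] both have parity opposite to [p], all flipped strings have parity [p] and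
    [flip_sum_even] applies. Otherwise a factor of every term is zero. *)
Lemma flip_sum_parity_part p a a' b c :
  flip_sum (fun b' c' => parity_part p a b' * parity_part p a' c') b c = 0.
Proof.
rewrite /flip_sum /parity_part.
have [bc|nbc] := boolP ((parity b != p) && (parity c != p)).
  case/andP: bc => bp cp; rewrite -[RHS](@flip_sum_even (a, a') b c);
    last first.
    by rewrite odd_diff_set; move: bp cp; case: (parity b); case: (parity c);
      case: (p).
  apply: eq_bigr => j _; rewrite !parity_flip.
  have -> : ~~ parity b == p by move: bp; case: (parity b); case: (p).
  by have -> : ~~ parity c == p by move: cp; case: (parity c); case: (p).
apply: big1 => j _; rewrite !parity_flip.
move: nbc; case: (parity b) (parity c) p => [] [] [] //= _;
  by rewrite ?mul0r ?mulr0.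
Qed.

Lemma parity_part_rank1 p : exists g (c : A -> R), forall a b,
  parity_part p a b = c a * g b.
Proof.
have [/existsP[[a0 b0] /= nz]|/existsPn z] :=
    boolP [exists t : A * B, parity_part p t.1 t.2 != 0].
  exists (parity_part p a0), (fun a =>
    parity_part p a b0 / parity_part p a0 b0) => a b.
  by apply: flip_sum_rigid nz b; apply: flip_sum_parity_part.
exists (fun=> 0), (fun=> 0) => a b; rewrite mulr0.
by apply/eqP; have := z (a, b); rewrite negbK.
Qed.

Lemma equality_vectors_rank2 : exists (g : bool -> B -> R) (c : A -> bool -> R),
  forall a b, v a b = \sum_p c a p * g p b.
Proof.
have [g0 [c0 e0]] := parity_part_rank1 false;
  have [g1 [c1 e1]] := parity_part_rank1 true.
exists (fun p => if p then g1 else g0), (fun a p =>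
  if p then c1 a else c0 a) => a b.
rewrite big_bool /= -e0 -e1 /parity_part.
by case: (parity b); rewrite ?addr0 ?add0r.
Qed.

End EqualityRigidity.

(** * From bit strings to matrices, and the rank bound *)

Lemma bits_val_inj (s t : seq bool) :
  size s = size t -> bits_val s = bits_val t -> s = t.
Proof.
elim: s t => [|c s IHs] [|d t] //= [est]; have := bits_val_lt s;
  have := bits_val_lt t.
rewrite est; case: c; case: d; rewrite ?mul1n ?mul0n ?add0n => ht hs e;
  try by lia.
- by rewrite (IHs t) //; lia.
- by rewrite (IHs t).
Qed.

Definition ffun_index (l : nat) (b : {ffun 'I_l -> bool}) : 'I_(2 ^ l) :=
  bits_index [tuple b i | i < l].

Lemma ffun_index_bij l : bijective (@ffun_index l).
Proof.
apply: inj_card_bij => [b c /(congr1 val) /= e|]; last first.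
  by rewrite card_ord card_ffun card_bool card_ord.
have e' : [tuple b i | i < l] = [tuple c i | i < l].
  by apply: val_inj; apply: bits_val_inj e; rewrite !size_tuple.
by apply/ffunP => i; have := congr1 (fun t => tnth t i) e';
  rewrite !tnth_mktuple.
Qed.

Lemma boolean_transform_equality (R : comNzRingType) (n q l : nat)
    (M : 'M[R]_(q, 2 ^ l)) (b : {ffun 'I_(n.+1 * l) -> bool}) :
  boolean_transform_sig (@equality_sig R n.+1 q) M b =
    \sum_a \prod_i M a (ffun_index (block b i)).
Proof.
have blockE i : (blocks b) i = ffun_index (block b i).
  rewrite /blocks ffunE; apply: val_inj; congr bits_val; congr val.
  by apply: eq_mktuple => j; rewrite ffunE.
rewrite /boolean_transform_sig /transform_sig /equality_sig.
rewrite (bigID (fun x : {ffun 'I_n.+1 -> 'I_q} =>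
  [forall i, forall j, x i == x j])) /=.
rewrite [X in _ + X]big1 ?addr0 => [|x /negPf->]; last by rewrite mul0r.
(* The constant assignments are indexed by their value at [ord0], which exists in arity [n.+1]. *)
rewrite (reindex_onto (fun a => [ffun=> a]) (fun x : {ffun 'I_n.+1 -> 'I_q} =>
  x ord0)) /=.
  apply: eq_big => [a|a /andP[-> _]].
    rewrite ffunE eqxx andbT; apply/forallP => i; apply/forallP => j.
    by rewrite !ffunE.
  by rewrite mul1r; apply: eq_bigr => i _; rewrite ffunE blockE.
move=> x /forallP cx; apply/ffunP => i; rewrite ffunE.
by have /forallP/(_ i)/eqP := cx ord0.
Qed.

Theorem theorem2 (R : realType) (n q : nat) (hn : (3 <= n)%N) (hq : (3 <= q)%N) :
  ~ exists (l : nat) (M : 'M[complex R]_(q, 2 ^ l)),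
      [/\ (1 <= l)%N,
          \rank M = q
        & matchgate_realizable
            (boolean_transform_sig (@equality_sig (complex R) n q) M)].
Proof.
case=> l [M [_ rankM [G sigG]]].
case: n hn G sigG => [|[|[|n]]] // _ G sigG.
(* Rank [q] gives a right inverse [N], whose columns are dual to the rows of [M]. *)
have /row_freeP[N MN] : row_free M by rewrite /row_free rankM.
pose v a b : complex R := M a (@ffun_index l b).
pose dual a b : complex R := N (@ffun_index l b) a.
have dualP a a' : \sum_b dual a b * v a' b = (a == a')%:R.
  have := congr1 (fun X : 'M__ => X a' a) MN; rewrite !mxE eq_sym => <-.
  rewrite (reindex (@ffun_index l)) /=; last exact/onW_bij/ffun_index_bij.
  by apply: eq_bigr => b _; rewrite mulrC.
have id (b c : {ffun 'I_(n.+3 * l) -> bool}) : flip_sum (fun b' c' =>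
  (\sum_a \prod_i v a (block b' i)) *
     (\sum_a \prod_i v a (block c' i))) b c = 0.
  rewrite -[RHS](matchgate_identity G b c); apply: eq_bigr => j _.
  by rewrite !sigG !boolean_transform_equality.
have [g [c e]] := equality_vectors_rank2 dualP (leibniz_identity id).
have [inv invK invK'] := ffun_index_bij l.
(* The two parities, with index 0 for [true], factor [M] through dimension 2, against its rank
   [q]. *)
pose X : 'M[complex R]_(q, 2) := \matrix_(a, p) c a (p == 0).
pose Y : 'M[complex R]_(2, 2 ^ l) := \matrix_(p, y) g (p == 0) (inv y).
have defM : M = X *m Y.
  apply/matrixP => a y; rewrite !mxE -[y]invK' -/(v a (inv y)) e big_bool /=.
  by rewrite !big_ord_recl big_ord0 !mxE /= addr0 invK.
by have := mulmx_max_rank X Y; rewrite -defM rankM leqNgt hq.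
Qed.
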